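(* Let $n\ge1$. If $J$ is a nontrivial $M$-ideal in $H^\infty(\mathbb{D}^n)$, then $J$ is norm dense in $H^2(\mathbb{D}^n)$: $$\overline{J}^{H^2(\mathbb{D}^n)}=H^2(\mathbb{D}^n).$$
   Context: $\mathbb{D}$ is the open unit disc in $\mathbb{C}$, $\mathbb{T}$ the unit circle, $\mu$ normalized Lebesgue measure on $\mathbb{T}^n$. $H^\infty(\mathbb{D}^n)$ is the Banach algebra of bounded holomorphic functions on $\mathbb{D}^n$ with the supremum norm, and $H^2(\mathbb{D}^n)$ is the Hardy space of holomorphic $f$ on $\mathbb{D}^n$ with $\|f\|_2=\left(\sup_{0<r<1}\int_{\mathbb{T}^n}|f(rz)|^2\,d\mu(z)\right)^{1/2}<\infty$; $H^\infty(\mathbb{D}^n)\subseteq H^2(\mathbb{D}^n)$ contractively. $\overline{J}^{H^2(\mathbb{D}^n)}$ is the closure of $J$ in the norm of $H^2(\mathbb{D}^n)$. ''Nontrivial'' means $\ne\{0\}$. $M$-ideal: a closed subspace $C$ of a complex Banach space $X$ is an $M$-ideal in $X$ if there is a bounded linear projection $P:X^*\to X^*$ ($P^2=P$) with $\operatorname{ran}P=C^\perp=\{x^*\in X^*: x^*|_C\equiv0\}$ and $\|Px^*\|+\|(I-P)x^*\|=\|x^*\|$ for all $x^*\in X^*$. *)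

(* Defs.v *)
From HB Require Import structures.
From mathcomp Require Import all_boot all_order all_algebra.
From mathcomp Require Import all_classical all_reals all_analysis.
From mathcomp Require Import complex.

Set Implicit Arguments.
Unset Strict Implicit.
Unset Printing Implicit Defensive.

Import Order.TTheory GRing.Theory Num.Theory.
Import numFieldNormedType.Exports.
Import ComplexField.Normc.

Local Open Scope classical_set_scope.
Local Open Scope ring_scope.
Local Open Scope complex_scope.

(* [numFieldNormedType.Exports] only covers abstract number fields; these are
   the same instances at the concrete field R[i].  The norm of R[i] is
   [`|z| = (normc z)%:C], so that norms over R[i] are R[i]-valued; [normc z] is
   the real modulus. *)
HB.instance Definition _ (R : realType) := GRing.ComAlgebra.copy R[i] R[i]^o.
HB.instance Definition _ (R : realType) := Vector.copy R[i] R[i]^o.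
HB.instance Definition _ (R : realType) := NormedModule.copy R[i] R[i]^o.

Section SupNorm.
Context {R : realType} {T : Type}.
Implicit Types (D : set T) (f g : T -> R[i]).

Definition bounded_on D f := exists M : R, forall x, D x -> normc (f x) <= M.

Definition supnorm D f : R := sup [set normc (f x) | x in D].

Lemma normc_ge0 (z : R[i]) : 0 <= normc z.
Proof. by case: z => a b /=; rewrite sqrtr_ge0. Qed.

Lemma bounded_on0 D : bounded_on D (0 : T -> R[i]).
Proof. by exists 0 => x _; rewrite normc0. Qed.

Lemma bounded_onP D a f g :
  bounded_on D f -> bounded_on D g -> bounded_on D (a *: f + g).
Proof.
move=> [M hM] [N hN]; exists (normc a * M + N) => x Dx.
rewrite (le_trans (le_normcD _ _)) ?lerD ?hN// normcM.
by rewrite ler_wpM2l ?normc_ge0 ?hM.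
Qed.

Lemma bounded_on_ubound D f : bounded_on D f ->
  has_ubound [set normc (f x) | x in D].
Proof. by move=> [M hM]; exists M => _ [x Dx <-]; exact: hM. Qed.

Lemma le_supnorm D f x : bounded_on D f -> D x -> normc (f x) <= supnorm D f.
Proof.
by move=> bf Dx; apply: ub_le_sup; [exact: bounded_on_ubound|exists x].
Qed.

Lemma supnorm_le D f (M : R) : D !=set0 ->
  (forall x, D x -> normc (f x) <= M) -> supnorm D f <= M.
Proof.
move=> [x0 Dx0] h; apply: ge_sup; first by exists (normc (f x0)), x0.
by move=> _ [x Dx <-]; exact: h.
Qed.

Lemma supnormD D f g : D !=set0 -> bounded_on D f -> bounded_on D g ->
  supnorm D (f + g) <= supnorm D f + supnorm D g.
Proof.
move=> D0 bf bg; apply: supnorm_le => // x Dx.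
by rewrite (le_trans (le_normcD _ _))// lerD// le_supnorm.
Qed.

Lemma supnormZ_le D a f : D !=set0 -> bounded_on D f ->
  supnorm D (a *: f) <= normc a * supnorm D f.
Proof.
move=> D0 bf; apply: supnorm_le => // x Dx.
by rewrite normcM ler_wpM2l ?normc_ge0// le_supnorm.
Qed.

Lemma supnormZ D a f : D !=set0 -> bounded_on D f ->
  supnorm D (a *: f) = normc a * supnorm D f.
Proof.
move=> D0 bf; apply/eqP; rewrite eq_le supnormZ_le//=.
have baf : bounded_on D (a *: f).
  by rewrite -[_ *: _]addr0; apply: bounded_onP => //; exact: bounded_on0.
have s0 : 0 <= supnorm D (a *: f).
  have [x Dx] := D0; apply: le_trans (le_supnorm baf Dx); exact: normc_ge0.
have [a0|a0] := eqVneq a 0; first by rewrite [in leLHS]a0 normc0 mul0r.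
have na0 : 0 < normc a.
  rewrite lt_neqAle normc_ge0 andbT eq_sym.
  by apply: contra a0 => /eqP/eq0_normc ->.
rewrite mulrC -ler_pdivlMr// mulrC -normcV.
by rewrite -[f in leLHS](scalerK a0) supnormZ_le.
Qed.

Lemma supnorm_eq0 D f : bounded_on D f -> supnorm D f = 0 ->
  forall x, D x -> f x = 0.
Proof.
move=> bf f0 x Dx; apply: eq0_normc; apply/eqP.
by rewrite eq_le normc_ge0 andbT -f0 le_supnorm.
Qed.

End SupNorm.

Section Dual.
Context {R : realType}.
Implicit Types X : normedModType R[i].

Definition functional X : {pred X -> R[i]} :=
  fun phi => `[< linear phi /\ continuous phi >].

Lemma functional_submod_closed X : submod_closed (@functional X).
Proof.
split=> [|a f g /asboolP[lf cf] /asboolP[lg cg]]; apply/asboolP; split.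
- by move=> b x y; rewrite /= scaler0 addr0.
- exact: cst_continuous.
- move=> b x y; rewrite !fctE lf lg !scalerDr !scalerA mulrC.
  by rewrite -!addrA; congr (_ + _); rewrite addrCA.
- move=> x; apply: continuousD; last exact: cg.
  by apply: (@continuousM _ _ (fun=> a) f); [exact: cst_continuous|exact: cf].
Qed.

HB.instance Definition _ X :=
  GRing.isSubmodClosed.Build R[i] (X -> R[i]) (@functional X)
    (@functional_submod_closed X).

Record dual X := Dual {
  dual_fun :> X -> R[i];
  dual_funP : dual_fun \in @functional X }.

HB.instance Definition _ X := [isSub for @dual_fun X].
HB.instance Definition _ X := [Choice of dual X by <:].
HB.instance Definition _ X := [SubChoice_isSubLmodule of dual X by <:].

Lemma dual_linear X (phi : dual X) : linear phi.
Proof. by case: phi => /= phi /asboolP[]. Qed.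

HB.instance Definition _ X (phi : dual X) :=
  GRing.isLinear.Build R[i] X R[i] _ (dual_fun phi) (dual_linear phi).

Lemma dual_continuous X (phi : dual X) : continuous phi.
Proof. by case: phi => /= phi /asboolP[]. Qed.

Definition unit_ball X : set X := [set x | `|x| <= 1].

Lemma unit_ball_neq0 X : @unit_ball X !=set0.
Proof. by exists 0; rewrite /unit_ball/= normr0. Qed.

Lemma dual_bounded_on X (phi : dual X) : bounded_on (@unit_ball X) phi.
Proof.
have /linear_bounded_continuous/bounded_funP/(_ 1)[M hM] :=
  @dual_continuous X phi.
by exists (complex.Re M) => x /hM; rewrite lecE => /andP[_ ].
Qed.

Lemma dual_eq0 X (phi : dual X) :
  (forall x, unit_ball x -> phi x = 0) -> phi = 0.
Proof.
move=> h; apply/val_inj/funext => x /=.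
have [->|x0] := eqVneq x 0; first by rewrite linear0.
have nx0 : `|x| != 0 by rewrite normr_eq0.
rewrite -[x](scalerKV nx0) linearZ/= h ?scaler0//.
by rewrite /unit_ball/= normrZ normfV normr_id mulVf.
Qed.

Definition opnorm X (phi : dual X) : R[i] := (supnorm (@unit_ball X) phi)%:C.

Lemma opnormD X (phi psi : dual X) :
  opnorm (phi + psi) <= opnorm phi + opnorm psi.
Proof.
rewrite /opnorm -rmorphD lecR.
apply: supnormD; [exact: unit_ball_neq0|exact: dual_bounded_on..].
Qed.

Lemma opnormZ X (a : R[i]) (phi : dual X) :
  opnorm (a *: phi) = `|a| * opnorm phi.
Proof.
rewrite /opnorm supnormZ; [|exact: unit_ball_neq0|exact: dual_bounded_on].
exact: (rmorphM (real_complex R)).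
Qed.

Lemma opnorm_eq0 X (phi : dual X) : opnorm phi = 0 -> phi = 0.
Proof.
move=> /complexI p0; apply: dual_eq0.
exact: supnorm_eq0 (@dual_bounded_on _ phi) p0.
Qed.

HB.instance Definition _ X :=
  Lmodule_isNormed.Build R[i] (dual X) (@opnormD X) (@opnormZ X) (@opnorm_eq0 X).

End Dual.

Section MIdeal.
Context {R : realType} {X : normedModType R[i]}.
Implicit Types C : set X.

Definition is_subspace C :=
  C 0 /\ forall (a : R[i]) x y, C x -> C y -> C (a *: x + y).

Definition annihilator C : set (dual X) :=
  [set phi | forall x, C x -> phi x = 0].

Definition is_L_projection (P : {linear dual X -> dual X}) :=
  [/\ continuous P, forall phi, P (P phi) = P phi &
      forall phi, `|P phi| + `|phi - P phi| = `|phi|].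

Definition is_M_ideal C :=
  [/\ closed C, is_subspace C &
      exists2 P : {linear dual X -> dual X},
        is_L_projection P & range P = annihilator C].

End MIdeal.

Section Polydisc.
Context {R : realType}.
Variable n : nat.
Local Notation Cn := 'rV[R[i]]_n.

Definition polydisc : set Cn := [set z | forall i, normc (z ord0 i) < 1].

Lemma polydisc_neq0 : polydisc !=set0.
Proof. by exists 0 => i; rewrite mxE normc0. Qed.

(* Complex (Frechet) differentiability: the scalar field is R[i]. *)
Definition holomorphic (f : Cn -> R[i]) :=
  forall z, polydisc z -> differentiable f z.

(* A function on the polydisc is represented by its extension by zero to C^n,
   so that equality of representatives is equality on the polydisc. *)
Definition zero_off_polydisc (f : Cn -> R[i]) :=
  forall z, ~ polydisc z -> f z = 0.

Definition bounded_holomorphic : {pred Cn -> R[i]} :=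
  fun f =>
    `[< [/\ holomorphic f, zero_off_polydisc f & bounded_on polydisc f] >].

Lemma bounded_holomorphic_submod_closed : submod_closed bounded_holomorphic.
Proof.
split=> [|a f g /asboolP[df f0 bf] /asboolP[dg g0 bg]]; apply/asboolP.
  by split=> [z _|//|]; [exact: differentiable_cst|exact: bounded_on0].
split; last exact: bounded_onP.
- move=> z Dz.
  by apply: differentiableD; [apply: differentiableZ; exact: df|exact: dg].
- by move=> z Dz; rewrite !fctE f0// g0// scaler0 addr0.
Qed.

HB.instance Definition _ :=
  GRing.isSubmodClosed.Build R[i] (Cn -> R[i]) bounded_holomorphic
    bounded_holomorphic_submod_closed.

Record Hinfty := HinftyOf {
  Hinfty_fun :> Cn -> R[i];
  HinftyP : Hinfty_fun \in bounded_holomorphic }.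

HB.instance Definition _ := [isSub for Hinfty_fun].
HB.instance Definition _ := [Choice of Hinfty by <:].
HB.instance Definition _ := [SubChoice_isSubLmodule of Hinfty by <:].

Definition Hinfty_norm (f : Hinfty) : R[i] := (supnorm polydisc f)%:C.

Lemma Hinfty_bounded (f : Hinfty) : bounded_on polydisc f.
Proof. by case: f => f /= /asboolP[]. Qed.

Lemma Hinfty_normD f g :
  Hinfty_norm (f + g) <= Hinfty_norm f + Hinfty_norm g.
Proof.
rewrite /Hinfty_norm -rmorphD lecR.
apply: supnormD; [exact: polydisc_neq0|exact: Hinfty_bounded..].
Qed.

Lemma Hinfty_normZ (a : R[i]) f :
  Hinfty_norm (a *: f) = `|a| * Hinfty_norm f.
Proof.
rewrite /Hinfty_norm supnormZ; [|exact: polydisc_neq0|exact: Hinfty_bounded].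
exact: (rmorphM (real_complex R)).
Qed.

Lemma Hinfty_norm_eq0 f : Hinfty_norm f = 0 -> f = 0.
Proof.
move=> /complexI f0; apply/val_inj/funext => z /=.
have [Dz|nDz] := pselect (polydisc z).
  exact: supnorm_eq0 (@Hinfty_bounded f) f0 _ Dz.
by case: f {f0} => f /= /asboolP[_ f0 _]; exact: f0.
Qed.

HB.instance Definition _ :=
  Lmodule_isNormed.Build R[i] Hinfty Hinfty_normD Hinfty_normZ Hinfty_norm_eq0.

End Polydisc.
Arguments polydisc : clear implicits.
Arguments Hinfty : clear implicits.

Section Torus.
Context {R : realType}.
Local Notation angle := (measurableTypeR R).

Lemma two_pi_gt0 : 0 < 2 * pi :> R.
Proof. by rewrite mulr_gt0// pi_gt0. Qed.

Definition tuple_cons n (p : angle * n.-tuple angle) : n.+1.-tuple angle :=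
  [the n.+1.-tuple angle of p.1 :: p.2].

Lemma measurable_tuple_cons n : measurable_fun setT (@tuple_cons n).
Proof. exact: measurable_cons. Qed.

HB.instance Definition _ n :=
  isMeasurableFun.Build _ _ _ _ (@tuple_cons n) (@measurable_tuple_cons n).

(* The torus T^n is parametrized by n-tuples of angles; its normalized Lebesgue
   measure is the n-fold product of the uniform probability on [0, 2 pi]. *)
Fixpoint torus_measure n : probability (n.-tuple angle) R :=
  match n with
  | 0 => dirac [tuple]
  | m.+1 => distribution (uniform_prob two_pi_gt0 \x torus_measure m)%E
              (@tuple_cons m)
  end.

Definition torus_point n (t : n.-tuple angle) : 'rV[R[i]]_n :=
  \row_i (cos (tnth t i) +i* sin (tnth t i)).

End Torus.

Section Hardy.
Context {R : realType}.
Variable n : nat.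
Local Notation Cn := 'rV[R[i]]_n.

Definition H2norm (f : Cn -> R[i]) : \bar R :=
  sqrte (ereal_sup
    [set (\int[torus_measure n]_t
            (normc (f (r%:C *: torus_point t)) ^+ 2)%:E)%E | r in `]0, 1[ ]).

Definition H2 : set (Cn -> R[i]) :=
  [set f | [/\ holomorphic f, zero_off_polydisc f & (H2norm f < +oo)%E]].

Definition H2closure (A : set (Cn -> R[i])) : set (Cn -> R[i]) :=
  [set f | H2 f /\
     forall e : R, 0 < e -> exists2 g, A g & (H2norm (f - g)%R < e%:E)%E].

End Hardy.
Arguments H2 : clear implicits.

(* Main.v *)
Require Import Defs.
From HB Require Import structures.
From mathcomp Require Import all_boot all_order all_algebra.
From mathcomp Require Import all_classical all_reals all_analysis.
From mathcomp Require Import measurable_realfun complex ring lra.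

Set Implicit Arguments.
Unset Strict Implicit.
Unset Printing Implicit Defensive.

Import Order.TTheory GRing.Theory Num.Theory.
Import numFieldNormedType.Exports.
Import ComplexField.Normc.

Local Open Scope classical_set_scope.
Local Open Scope ring_scope.
Local Open Scope complex_scope.

(** Let [P] be the L-projection onto the annihilator of [J] and write [|.|] for
    the modulus.  Two facts make [J] dense.

    First, [J] has the two-ball property ([two_ball]): if [x] is in the unit
    ball of [Hinfty] and [u] is in the unit ball of [J], then for every
    [eta > 0] some [y] in [J] has both [x - y + u] and [x - y - u] in the ball
    of radius [1 + eta].  This is Hahn-Banach separation in the square of the
    space, combined with the additivity of the norm along [P].  By the
    parallelogram law [|x - y| ^+ 2 + |u| ^+ 2 <= (1 + eta) ^+ 2] at every point
    of the polydisc.  Hence, if [|u|] is close to 1 in the mean on the tori of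
    radius [r < 1], then [y] is close to [x] in the Hardy norm.  As
    [|u| ^+ 2 >= 2 Re u - 1] and the mean of [Re u] over such a torus is
    [Re (u 0)], it is enough that [Re (u 0)] be close to 1.

    Second, such a [u] exists as soon as [J] is not zero.  At a point [z] where
    some member of [J] does not vanish, evaluation splits along [P] into two
    positive functionals; testing them on [1 / (1 - c u)] shows that one of
    them is zero, and then the members of the unit ball of [J] take values
    arbitrarily close to 1 at [z] ([near_one_at_point]).  Harnack's inequality
    for the positive harmonic functions [1 - Re u] carries this to the origin
    ([near_one_at_zero]).

    So the closure of [J] contains [Hinfty].  Finally [Hinfty] is dense in the
    Hardy space, since the dilations of a function converge to it in the Hardy
    norm ([dilate_approx]).  This follows from two properties of the square
    means [hmean f r] on the tori of radius [r]: the mean of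
    [f (a t) * (f (b t))^*] depends only on [a * b] ([tmean_pairing]), and the
    square means increase with [r] ([hmean_mono]).

    The function theory is one-dimensional.  The measure of the torus is
    invariant under the rotations [t |-> u t] with [|u| = 1], so a mean over
    the torus is a mean of circular means on the slices [u |-> f (u t)]
    ([torus_average]).  Circular means of holomorphic functions do not depend
    on the radius ([circle_mean_strip]); this is Goursat's theorem in
    logarithmic coordinates, where circles become vertical segments. *)

(** * The Hahn-Banach theorem *)

Section HahnBanach.
Context {R : realType} {V : lmodType R[i]}.
Implicit Types (q s L : V -> R) (x y v : V).

(** Scalars are real: the functionals to be dominated are the real parts of
    complex-linear ones. *)
Definition sublinear q :=
  (forall x y, q (x + y) <= q x + q y) /\
  (forall (t : R) x, 0 <= t -> q (t%:C *: x) = t * q x).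

Definition real_linear L :=
  (forall x y, L (x + y) = L x + L y) /\
  (forall (t : R) x, L (t%:C *: x) = t * L x).

Lemma sublinear0 q : sublinear q -> q 0 = 0.
Proof. by move=> [_ /(_ 0 0 (lexx _))]; rewrite scaler0 mul0r. Qed.

Lemma sublinearN q x : sublinear q -> - q (- x) <= q x.
Proof.
move=> sq; have [qD _] := sq.
by have := qD x (- x); rewrite subrr sublinear0// -lerBlDr sub0r.
Qed.

(** The largest sublinear minorant of [s] whose value at [- v] is at most
    [- s v].  A minimal sublinear functional coincides with all of these, which
    makes it odd and additive, that is, linear. *)
Definition straighten v s x : R :=
  inf [set s (x + t%:C *: v) - t * s v | t in [set t : R | 0 <= t]].

Section straighten.
Variables (v : V) (s : V -> R).
Hypothesis ss : sublinear s.

Let lb x (t : R) : 0 <= t -> - s (- x) <= s (x + t%:C *: v) - t * s v.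
Proof.
move=> t0; have [sD sZ] := ss.
have := sD (x + t%:C *: v) (- x).
by rewrite addrAC subrr add0r sZ//; lra.
Qed.

Let has x : has_inf [set s (x + t%:C *: v) - t * s v | t in [set t : R | 0 <= t]].
Proof.
split; first by exists (s (x + 0%:C *: v) - 0 * s v), 0 => //=.
by exists (- s (- x)) => _ [t /= t0 <-]; exact: lb.
Qed.

Lemma straighten_le x (t : R) : 0 <= t ->
  straighten v s x <= s (x + t%:C *: v) - t * s v.
Proof. by move=> t0; apply: ge_inf; [case: (has x)|exists t]. Qed.

Lemma le_straighten x (m : R) :
  (forall t : R, 0 <= t -> m <= s (x + t%:C *: v) - t * s v) ->
  m <= straighten v s x.
Proof.
by move=> h; apply: lb_le_inf; [case: (has x)|move=> _ [t t0 <-]; exact: h].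
Qed.

Lemma straighten_self x : straighten v s x <= s x.
Proof. by have := straighten_le x (lexx 0); rewrite scale0r addr0 mul0r subr0. Qed.

Lemma straighten_sublinear : sublinear (straighten v s).
Proof.
have [sD sZ] := ss; split.
  move=> x y; rewrite -lerBlDr; apply: le_straighten => t t0.
  rewrite lerBlDr -lerBlDl; apply: le_straighten => u u0.
  rewrite lerBlDl; have tu0 : 0 <= t + u by rewrite addr_ge0.
  apply: (le_trans (straighten_le (x + y) tu0)).
  have := sD (x + t%:C *: v) (y + u%:C *: v).
  by rewrite addrACA -scalerDl -rmorphD mulrDl/=; lra.
suff H (t : R) x : 0 < t ->
    t * straighten v s x <= straighten v s (t%:C *: x).
  move=> t x; rewrite le_eqVlt => /predU1P[<-|t0].
    rewrite mul0r scale0r; apply/eqP; rewrite eq_le; apply/andP; split.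
      by rewrite (le_trans (straighten_self _))// sublinear0.
    apply: le_straighten => u u0; rewrite add0r sZ//; lra.
  apply/eqP; rewrite eq_le H// andbT.
  have ti0 : 0 < t^-1 by rewrite invr_gt0.
  have := H _ (t%:C *: x) ti0.
  by rewrite scalerA -rmorphM/= mulVf ?gt_eqF// scale1r ler_pdivrMl.
move=> t0; apply: le_straighten => u u0.
rewrite -ler_pdivlMl//; apply: (le_trans (straighten_le x (_ : 0 <= u / t))).
  by rewrite divr_ge0// ltW.
have -> : x + (u / t)%:C *: v = t^-1%:C *: (t%:C *: x + u%:C *: v).
  by rewrite scalerDr !scalerA -!rmorphM/= mulVf ?gt_eqF// scale1r mulrC.
rewrite sZ ?invr_ge0 ?(ltW t0)//; lra.
Qed.

Lemma straightenN : straighten v s (- v) <= - s v.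
Proof.
have := straighten_le (- v) (ler01 : (0 <= 1 :> R)%R).
by rewrite scale1r addNr sublinear0// mul1r sub0r.
Qed.

End straighten.

(** Zorn's lemma: the pointwise infimum of a chain of sublinear functionals is
    sublinear, and it is finite since each of them is bounded below by
    [- q (- x)]. *)
Lemma minimal_sublinear q : sublinear q ->
  exists s, [/\ sublinear s, forall x, s x <= q x &
    forall s', sublinear s' -> (forall x, s' x <= s x) -> s' = s].
Proof.
move=> sq.
pose T := {s : V -> R | sublinear s /\ forall x, s x <= q x}.
pose le (s t : T) := `[< forall x, sval t x <= sval s x >].
have valinj (s t : T) : sval s = sval t -> s = t.
  by case: s t => [s hs] [t ht] /= st; exact: eq_exist.
have [||||m mmin] := @Zorn T le.
- by move=> t; apply/asboolP.
- move=> r s t /asboolP rs /asboolP st; apply/asboolP => x.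
  exact: le_trans (st x) (rs x).
- move=> s t /asboolP st /asboolP ts; apply: valinj; apply/funext => x.
  by apply/eqP; rewrite eq_le st ts.
- move=> A Atot; have [[a0 Aa0]|A0] := pselect (A !=set0); last first.
    exists (exist _ q (conj sq (fun x => lexx (q x)))) => s As.
    by exfalso; apply: A0; exists s.
  pose m x := inf [set sval s x | s in A].
  have hi x : has_inf [set sval s x | s in A].
    split; first by exists (sval a0 x), a0.
    exists (- q (- x)) => _ [s As <-].
    have [ss sle] := svalP s.
    by apply: le_trans (sublinearN x ss); rewrite lerN2.
  have mle x (s : T) : A s -> m x <= sval s x.
    by move=> As; apply: ge_inf; [case: (hi x)|exists s].
  have lem x (r : R) : (forall s : T, A s -> r <= sval s x) -> r <= m x.
    by move=> h; apply: lb_le_inf; [case: (hi x)|move=> _ [s As <-]; exact: h].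
  have sm : sublinear m.
    split.
      move=> x y; rewrite -lerBlDr; apply: (lem x) => s As.
      rewrite lerBlDr -lerBlDl; apply: (lem y) => t At; rewrite lerBlDl.
      have [/asboolP st|/asboolP ts] := Atot _ _ As At.
        have [[tD _] _] := svalP t.
        by apply: (le_trans (mle _ _ At)); apply: (le_trans (tD x y)); rewrite lerD.
      have [[sD _] _] := svalP s.
      by apply: (le_trans (mle _ _ As)); apply: (le_trans (sD x y)); rewrite lerD.
    move=> t x t0; apply/eqP; rewrite eq_le; apply/andP; split; last first.
      apply: lem => s As; have [[_ sZ] _] := svalP s.
      by rewrite sZ// ler_wpM2l// mle.
    move: t0; rewrite le0r => /predU1P[->|t0].
      rewrite (le_trans (mle _ _ Aa0))//; have [[_ sZ] _] := svalP a0.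
      by rewrite sZ// !mul0r.
    rewrite -ler_pdivrMl//; apply: lem => s As; rewrite ler_pdivrMl//.
    have [[_ sZ] _] := svalP s.
    by rewrite -sZ ?(ltW t0)// mle.
  have mq x : m x <= q x.
    by apply: (le_trans (mle _ _ Aa0)); have [_] := svalP a0.
  by exists (exist _ m (conj sm mq)) => s As; apply/asboolP => x; exact: mle.
- exists (sval m); have [sm mq] := svalP m; split => // s' ss' s'm.
  have s'q x : s' x <= q x by exact: le_trans (s'm x) (mq x).
  have := mmin (exist _ s' (conj ss' s'q)) (asboolT s'm).
  by move=> /(congr1 sval).
Qed.

(** Straightening at [v] forces the value [q v] on any smaller linear
    functional; a minimal one is linear. *)
Lemma hahn_banach q v : sublinear q ->
  exists L, [/\ real_linear L, forall x, L x <= q x & L v = q v].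
Proof.
move=> sq.
have [L [sL Lle Lmin]] := minimal_sublinear (straighten_sublinear v sq).
have [LD LZ] := sL.
have addL x w : L (x + w) = L x + L w.
  apply/eqP; rewrite eq_le LD/=.
  have E := Lmin _ (straighten_sublinear w sL) (straighten_self w sL).
  have := straighten_le w sL x ler01.
  by rewrite E scale1r mul1r lerBrDr.
have oppL x : L (- x) = - L x.
  by apply/eqP; rewrite -addr_eq0 -addL addNr sublinear0.
exists L; split.
- split=> // t x; have [t0|t0] := leP 0 t; first exact: LZ.
  have := LZ (- t) x; rewrite oppr_ge0 (ltW t0) => /(_ isT).
  by rewrite rmorphN/= scaleNr oppL mulNr => /oppr_inj.
- by move=> x; apply: le_trans (Lle x) (straighten_self v sq x).
- apply/eqP; rewrite eq_le (le_trans (Lle v) (straighten_self v sq v))/=.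
  rewrite -lerN2 -oppL; exact: le_trans (Lle _) (straightenN v sq).
Qed.

End HahnBanach.

Section Extension.
Context {R : realType} {V : lmodType R[i]}.

(** The infimum of [q (x - y) + l y] over [y] in [W] is sublinear in [x], and
    every linear functional below it extends [l].  The last conclusion says that
    its value at [v] is attained: for [l = 0] this is the distance from [v] to
    [W], so that the same statement gives norm-preserving extensions and the
    functionals that compute distances. *)
Lemma hahn_banach_extension (q l : V -> R) (W : set V) (v : V) :
  sublinear q -> real_linear l ->
  W 0 -> (forall (t : R) x y, W x -> W y -> W (t%:C *: x + y)) ->
  (forall x, W x -> l x <= q x) ->
  exists L, [/\ real_linear L, forall x, L x <= q x,
    forall x, W x -> L x = l x &
    forall m, (forall y, W y -> m <= q (v - y) + l y) -> m <= L v].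
Proof.
move=> sq [lD lZ] W0 WP lq; have [qD qZ] := sq.
have l0 : l 0 = 0 by have := lZ 0 0; rewrite scaler0 mul0r.
have lN x : l (- x) = - l x by apply/eqP; rewrite -addr_eq0 -lD addNr l0.
have WD x y : W x -> W y -> W (x + y).
  by move=> Wx Wy; rewrite -[x]scale1r; exact: (WP 1).
have WZ (t : R) x : W x -> W (t%:C *: x).
  by move=> Wx; rewrite -[_ *: _]addr0; exact: WP.
have WN x : W x -> W (- x).
  by move=> Wx; have := WZ (-1) x Wx; rewrite rmorphN/= scaleN1r.
pose s x := inf [set q (x - y) + l y | y in W].
have hi x : has_inf [set q (x - y) + l y | y in W].
  split; first by exists (q (x - 0) + l 0), 0.
  exists (- q (- x)) => _ [y Wy <-].
  have := lq _ (WN _ Wy); have := qD (x - y) (- x).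
  rewrite addrAC subrr add0r lN; lra.
have sle x y : W y -> s x <= q (x - y) + l y.
  by move=> Wy; apply: ge_inf; [case: (hi x)|exists y].
have les x (m : R) : (forall y, W y -> m <= q (x - y) + l y) -> m <= s x.
  by move=> h; apply: lb_le_inf; [case: (hi x)|move=> _ [y Wy <-]; exact: h].
have ss : sublinear s.
  split.
    move=> x y; rewrite -lerBlDr; apply: (les x) => a Wa.
    rewrite lerBlDr -lerBlDl; apply: (les y) => b Wb; rewrite lerBlDl.
    apply: (le_trans (sle _ _ (WD _ _ Wa Wb))).
    have := qD (x - a) (y - b); rewrite lD opprD addrACA; lra.
  have H (t : R) x : 0 < t -> t * s x <= s (t%:C *: x).
    move=> t0; apply: (les _) => y Wy; rewrite -ler_pdivlMl//.
    apply: (le_trans (sle _ _ (WZ t^-1 _ Wy))).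
    have -> : x - t^-1%:C *: y = t^-1%:C *: (t%:C *: x - y).
      by rewrite scalerBr scalerA -rmorphM/= mulVf ?gt_eqF// scale1r.
    by rewrite qZ ?invr_ge0 ?(ltW t0)// lZ mulrDr.
  move=> t x; rewrite le0r => /predU1P[->|t0].
    rewrite mul0r scale0r; apply/eqP; rewrite eq_le; apply/andP; split.
      by rewrite (le_trans (sle _ _ W0))// l0 addr0 subr0 sublinear0.
    by apply: (les _) => y Wy; have := lq _ (WN _ Wy); rewrite lN sub0r; lra.
  apply/eqP; rewrite eq_le H// andbT.
  have ti0 : 0 < t^-1 by rewrite invr_gt0.
  have := H _ (t%:C *: x) ti0.
  by rewrite scalerA -rmorphM/= mulVf ?gt_eqF// scale1r ler_pdivrMl.
have [L [[LD LZ] Ls Lv]] := hahn_banach v ss.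
have LW x : W x -> L x <= l x.
  move=> Wx; apply: (le_trans (Ls x)); apply: (le_trans (sle _ _ Wx)).
  by rewrite subrr sublinear0// add0r.
have LN x : L (- x) = - L x.
  apply/eqP; rewrite -addr_eq0 -LD addNr.
  by have := LZ 0 0; rewrite scaler0 mul0r => ->.
exists L; split => //.
- move=> x; apply: (le_trans (Ls x)); apply: (le_trans (sle _ _ W0)).
  by rewrite subr0 l0 addr0.
- move=> x Wx; apply/eqP; rewrite eq_le LW//=.
  by rewrite -lerN2 -LN -lN LW//; exact: WN.
- by move=> m hm; rewrite Lv; exact: les.
Qed.

End Extension.

(** * The complex modulus *)

Section ComplexFacts.
Context {R : realType}.
Implicit Types z w : R[i].

Lemma Re_le_normc z : complex.Re z <= normc z.
Proof.
case: z => a b /=; apply: (le_trans (ler_norm a)).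
by rewrite -sqrtr_sqr ler_wsqrtr// lerDl sqr_ge0.
Qed.

Lemma ReD z w : complex.Re (z + w) = complex.Re z + complex.Re w.
Proof. by case: z w => [a b] [c d]. Qed.

Lemma ReN z : complex.Re (- z) = - complex.Re z.
Proof. by case: z. Qed.

Lemma ReB z w : complex.Re (z - w) = complex.Re z - complex.Re w.
Proof. by rewrite ReD ReN. Qed.

Lemma ReZ (t : R) z : complex.Re (t%:C * z) = t * complex.Re z.
Proof. by case: z => a b /=; rewrite mul0r subr0. Qed.

Lemma normc_sqr z : normc z ^+ 2 = complex.Re z ^+ 2 + complex.Im z ^+ 2.
Proof. by case: z => a b /=; rewrite sqr_sqrtr// addr_ge0// sqr_ge0. Qed.

Lemma normc_real (t : R) : normc t%:C = `|t|.
Proof. by rewrite /= expr0n/= addr0 sqrtr_sqr. Qed.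

Lemma normcN z : normc (- z) = normc z.
Proof. by case: z => a b /=; rewrite !sqrrN. Qed.

Lemma normc_distC z w : normc (z - w) = normc (w - z).
Proof. by rewrite -normcN opprB. Qed.

Lemma exists_rotation z : exists2 u : R[i], normc u = 1 & u * z = (normc z)%:C.
Proof.
have [z0|z0] := eqVneq (normc z) 0.
  exists 1; first by rewrite normc_real normr1.
  by rewrite z0 (eq0_normc z0) mulr0.
exists ((normc z)^-1%:C * z^*); last first.
  have := normc_sqr z; move: z0; set N := normc z; case: z @N => a b N N0 NE.
  apply/eqP; rewrite eq_complex /=; apply/andP; split; apply/eqP; last ring.
  rewrite -[RHS](mulKf N0) -[N * N]expr2 NE /=; ring.
rewrite normcM normc_real ger0_norm ?invr_ge0 ?normc_ge0//.
have -> : normc z^* = normc z by case: z {z0} => a b /=; rewrite sqrrN.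
by rewrite mulVf.
Qed.

End ComplexFacts.

(** * Norms of functionals *)

Section DualFacts.
Context {R : realType} {X : normedModType R[i]}.
Implicit Types (x y : X) (phi psi : dual X).

Definition rnorm x : R := complex.Re `|x|.

Lemma rnormE x : `|x| = (rnorm x)%:C.
Proof.
have := normr_ge0 x; rewrite /rnorm; case: `|x| => a b.
by rewrite lecE/= => /andP[/eqP ->].
Qed.

Lemma rnorm_ge0 x : 0 <= rnorm x.
Proof. by have := normr_ge0 x; rewrite rnormE lecR. Qed.

Lemma rnormD x y : rnorm (x + y) <= rnorm x + rnorm y.
Proof. by have := ler_normD x y; rewrite !rnormE -rmorphD lecR. Qed.

Lemma normCE (a : R[i]) : `|a| = (normc a)%:C.
Proof. by []. Qed.

Lemma rnormZ (a : R[i]) x : rnorm (a *: x) = normc a * rnorm x.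
Proof.
apply: (@complexI R); rewrite -rnormE normrZ rnormE normCE.
by rewrite -(rmorphM (real_complex R)).
Qed.

Lemma rnorm_eq0 x : rnorm x = 0 -> x = 0.
Proof. by move=> x0; apply/normr0_eq0; rewrite rnormE x0. Qed.

Lemma dualD phi psi x : (phi + psi : dual X) x = phi x + psi x.
Proof. by []. Qed.

Lemma dualB phi psi x : (phi - psi : dual X) x = phi x - psi x.
Proof. by []. Qed.

Definition dualnorm phi : R := supnorm (@unit_ball R X) phi.

Lemma dual_normE phi : `|phi| = (dualnorm phi)%:C.
Proof. by []. Qed.

Lemma unit_ballP x : unit_ball x <-> rnorm x <= 1.
Proof. by rewrite /unit_ball/= rnormE lecR. Qed.

Lemma dualnorm_ge0 phi : 0 <= dualnorm phi.
Proof. by have := normr_ge0 phi; rewrite dual_normE lecR. Qed.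

Lemma le_dualnorm phi x : normc (phi x) <= dualnorm phi * rnorm x.
Proof.
have [/rnorm_eq0 ->|x0] := eqVneq (rnorm x) 0.
  by rewrite linear0 normc0 mulr_ge0// ?dualnorm_ge0// rnorm_ge0.
have xp : 0 < rnorm x by rewrite lt_neqAle eq_sym x0 rnorm_ge0.
rewrite -ler_pdivrMr// mulrC.
have -> : (rnorm x)^-1 * normc (phi x) = normc (phi ((rnorm x)^-1%:C *: x)).
  rewrite linearZ/= normcM normc_real ger0_norm// invr_ge0; exact: rnorm_ge0.
apply: le_supnorm; first exact: dual_bounded_on.
apply/unit_ballP; rewrite rnormZ normc_real ger0_norm ?invr_ge0 ?rnorm_ge0//.
by rewrite mulVf.
Qed.

Lemma Re_dual_le phi x : rnorm x <= 1 -> complex.Re (phi x) <= dualnorm phi.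
Proof.
move=> x1; apply: (le_trans (Re_le_normc _)); apply: (le_trans (le_dualnorm _ _)).
by rewrite ler_piMr// dualnorm_ge0.
Qed.

Lemma dualnorm_le phi (c : R) :
  (forall x, rnorm x <= 1 -> complex.Re (phi x) <= c) -> dualnorm phi <= c.
Proof.
move=> h; apply: supnorm_le => [|x /unit_ballP x1]; first exact: unit_ball_neq0.
have [u u1 uE] := exists_rotation (phi x).
have := h (u *: x); rewrite rnormZ u1 mul1r linearZ/= => /(_ x1).
by rewrite -[u *: phi x]/(u * phi x) uE.
Qed.

(** The complex functional is [x |-> L x - 'i * L ('i *: x)].  Rotating its
    value at [x] onto the positive axis turns the one-sided bound on [L] into a
    bound on its modulus. *)
Lemma dual_of_real (L : X -> R) (c : R) :
  real_linear L -> (forall x, L x <= c * rnorm x) ->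
  exists phi, forall x, complex.Re (phi x) = L x.
Proof.
move=> [LD LZ] Lc.
pose f x : R[i] := L x +i* - L ('i *: x).
have LN x : L (- x) = - L x.
  by have := LZ (-1) x; rewrite rmorphN/= scaleN1r mulN1r.
have fl : linear f.
  move=> [a b] x y; rewrite /f.
  have aE : (a +i* b) = a%:C + b%:C * 'i.
    by apply/eqP; rewrite eq_complex/= !mul0r !mulr0 !mulr1 subrr !addr0 add0r !eqxx.
  have iiE : 'i * ((a +i* b)) = a%:C * 'i + (- b)%:C.
    by apply/eqP; rewrite eq_complex/=; apply/andP; split; apply/eqP; ring.
  rewrite scalerDr [X in - L X]addrC LD [X in - X]LD scalerA iiE aE !scalerDl.
  rewrite -!scalerA !LD !LZ.
  apply/eqP; rewrite eq_complex/=; apply/andP; split; apply/eqP => /=; ring.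
have fc : continuous f.
  have fb x : normc (f x) <= c * rnorm x.
    have [u u1 uE] := exists_rotation (f x).
    have : complex.Re (u * f x) <= c * rnorm x.
      have -> : u * f x = f (u *: x).
        by have := fl u x 0; rewrite !addr0 => ->; rewrite /f !scaler0 -(scale0r 0) LZ mul0r oppr0 addr0.
      by rewrite /f/= (le_trans (Lc _))// rnormZ u1 mul1r.
    by rewrite uE.
  pose fL : {linear X -> R[i]} := HB.pack f (GRing.isLinear.Build _ _ _ _ f fl).
  apply: (@linear_bounded_continuous _ _ _ fL).1; apply/linear_boundedP.
  exists c%:C; split; first by rewrite realE !lecE /= eqxx; exact: le_total.
  move=> r cr x; rewrite normCE; apply: (@le_trans _ _ (c%:C * `|x|)).
    by rewrite rnormE -rmorphM lecR fb.
  by rewrite ler_wpM2r// ltW.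
by exists (Dual (asboolT (conj fl fc))).
Qed.

End DualFacts.

(** * The two-ball property of M-ideals *)

Section MIdealFacts.
Context {R : realType} {X : normedModType R[i]}.
Variables (J : set X) (P : {linear dual X -> dual X}).
Hypotheses (Jsub : is_subspace J) (PL : is_L_projection P)
  (PJ : range P = annihilator J).

Let J0 : J 0. Proof. by case: Jsub. Qed.
Let JZ a x : J x -> J (a *: x).
Proof. by move=> Jx; rewrite -[_ *: _]addr0; apply: Jsub.2. Qed.

Lemma Lproj_norm (phi : dual X) : dualnorm (P phi) + dualnorm (phi - P phi) = dualnorm phi.
Proof.
have [_ _ /(_ phi)] := PL.
by rewrite !dual_normE -rmorphD => /(@complexI R).
Qed.

Lemma Lproj_ann (phi : dual X) y : J y -> P phi y = 0.
Proof.
have : range P (P phi) by exists phi.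
by rewrite PJ => /(_ y).
Qed.

Lemma ann_Lproj (phi : dual X) : (forall y, J y -> complex.Re (phi y) = 0) -> P phi = phi.
Proof.
move=> h.
have : annihilator J phi.
  move=> y Jy; have := h _ (JZ 'i Jy); rewrite linearZ/=; have := h _ Jy.
  case: (phi y) => a b /= -> H; apply/eqP; rewrite eq_complex/= eqxx/=.
  by apply/eqP; move: H; lra.
by rewrite -PJ => -[psi _ <-]; case: PL => _ + _; exact.
Qed.

Lemma real_linear_Re (phi : dual X) : real_linear (fun x => complex.Re (phi x)).
Proof.
by split=> [x y|t x]; rewrite ?linearD ?linearZ ?ReD//= -[_ *: _]/(_ * _) ReZ.
Qed.

Lemma sublinear_rnorm (c : R) : 0 <= c -> sublinear (fun x : X => c * rnorm x).
Proof.
move=> c0; split=> [x y|t x t0]; first by rewrite -mulrDr ler_wpM2l// rnormD.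
by rewrite rnormZ normc_real ger0_norm// mulrCA.
Qed.

(** Functionals in the kernel of the L-projection are normed by [J]: a
    norm-preserving extension [psi] of the restriction to [J] differs from
    [phi] by an element of the annihilator, so that [phi = psi - P psi], and
    removing [P psi] does not increase the norm. *)
Lemma dualnorm_ker_Lproj (phi : dual X) (c : R) : P phi = 0 ->
  (forall y, J y -> rnorm y <= 1 -> complex.Re (phi y) <= c) -> dualnorm phi <= c.
Proof.
move=> Pphi hc.
have c0 : 0 <= c.
  by have := hc 0 J0; rewrite linear0 /rnorm normr0/= => -> //.
have hJ y : J y -> complex.Re (phi y) <= c * rnorm y.
  move=> Jy; have [/rnorm_eq0 ->|y0] := eqVneq (rnorm y) 0.
    by rewrite linear0 mulr_ge0// rnorm_ge0.
  have yp : 0 < rnorm y by rewrite lt_neqAle eq_sym y0 rnorm_ge0.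
  have := hc _ (JZ (rnorm y)^-1%:C Jy).
  rewrite rnormZ normc_real ger0_norm ?invr_ge0 ?rnorm_ge0// mulVf//.
  by rewrite linearZ/= -[_ *: _]/(_ * _) ReZ ler_pdivrMl// mulrC => ->.
have [L [rL Lc LJ _]] := @hahn_banach_extension _ _ _ _ J 0 (sublinear_rnorm c0)
   (real_linear_Re phi) J0 (fun t x y Jx Jy => Jsub.2 t%:C x y Jx Jy) hJ.
have [psi psiL] := dual_of_real rL Lc.
have /ann_Lproj : forall y, J y -> complex.Re ((psi - phi) y) = 0.
  by move=> y Jy; rewrite dualB ReB psiL LJ// subrr.
rewrite linearB/= Pphi subr0 => E.
have -> : phi = psi - P psi by rewrite E opprB addrC subrK.
have psic : dualnorm psi <= c.
  apply: dualnorm_le => x x1; rewrite psiL (le_trans (Lc x))//.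
  by rewrite ler_piMr.
by apply: le_trans psic; rewrite -(Lproj_norm psi) lerDr dualnorm_ge0.
Qed.

(** The two-ball property: by Hahn-Banach the distance of [(x + e, x - e)] to
    the diagonal of [J] in [X * X] is the value there of a pair of functionals
    [(f1, f2)] of total norm at most 1 whose sum kills [J].  Then [P] fixes
    [f1 + f2], and since [P f1], [P f2] kill [e], the value only sees
    [P f1 + P f2] at [x] and the complementary parts at [e] and [- e]. *)
Lemma two_ball x e (eps : R) : rnorm x <= 1 -> J e -> rnorm e <= 1 -> 0 < eps ->
  exists y, [/\ J y, rnorm (x - y + e) < 1 + eps & rnorm (x - y - e) < 1 + eps].
Proof.
move=> x1 Je e1 eps0; apply: contrapT => /forallNP H.
pose q (u : (X * X)%type) := Num.max (rnorm u.1) (rnorm u.2).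
have sq : sublinear q.
  split=> [u v|t u t0]; rewrite /q/=.
    rewrite ge_max; apply/andP; split; apply: (le_trans (rnormD _ _)); apply: lerD;
      by rewrite le_max lexx ?orbT.
  by rewrite !rnormZ normc_real ger0_norm// maxr_pMr.
pose W := [set u : (X * X)%type | J u.1 /\ u.1 = u.2].
have W0 : W 0 by [].
have WP (t : R) u v : W u -> W v -> W (t%:C *: u + v).
  by case: u v => [u1 u2] [v1 v2] [/= Ju <-] [/= Jv <-]; split => //=; apply: Jsub.2.
have l0 : real_linear (fun _ : (X * X)%type => 0 : R).
  by split=> *; rewrite ?addr0 ?mulr0.
have q0 u : W u -> 0 <= q u by move=> _; rewrite le_max rnorm_ge0.
have [L [[LD LZ] Lq LW Lv]] := hahn_banach_extension (x + e, x - e) sq l0 W0 WP q0.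
have {}Lv : 1 + eps <= L (x + e, x - e).
  apply: Lv => -[y y'] [/= Jy <-]; rewrite addr0 leNgt; apply/negP => h.
  apply: (H y); move: h; rewrite /q/= gt_max => /andP[h1 h2]; split => //.
    by rewrite addrAC.
  by rewrite addrAC.
have pD (u v : X) : ((u + v, 0) = (u, 0) + (v, 0) :> (X * X)%type) *
   ((0, u + v) = (0, u) + (0, v) :> (X * X)%type).
  by split; congr (_, _); rewrite /= addr0.
have pZ (t : R) (u : X) : ((t%:C *: u, 0) = t%:C *: (u, 0) :> (X * X)%type) *
   ((0, t%:C *: u) = t%:C *: (0, u) :> (X * X)%type).
  by split; congr (_, _); rewrite /= scaler0.
have n0 : rnorm (0 : X) = 0 by rewrite /rnorm normr0.
have [||f1 f1E] := @dual_of_real _ _ (fun u => L (u, 0)) 1.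
- by split=> *; rewrite ?pD ?pZ ?LD ?LZ.
- by move=> u; rewrite (le_trans (Lq _))// /q/= n0 mul1r ge_max lexx rnorm_ge0.
have [||f2 f2E] := @dual_of_real _ _ (fun u => L (0, u)) 1.
- by split=> *; rewrite ?pD ?pZ ?LD ?LZ.
- by move=> u; rewrite (le_trans (Lq _))// /q/= n0 mul1r ge_max lexx rnorm_ge0.
have LE u v : L (u, v) = complex.Re (f1 u) + complex.Re (f2 v).
  by rewrite f1E f2E -LD; congr (L (_, _)); rewrite /= ?addr0 ?add0r.
have nf : dualnorm f1 + dualnorm f2 <= 1.
  rewrite -lerBrDr; apply: dualnorm_le => u u1; rewrite lerBrDr -lerBrDl.
  apply: dualnorm_le => v v1; rewrite lerBrDl -LE (le_trans (Lq _))//.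
  by rewrite /q ge_max/= u1 v1.
have PE : P f1 + P f2 = f1 + f2.
  rewrite -linearD; apply: ann_Lproj => y Jy.
  by rewrite dualD ReD -LE LW.
have val : complex.Re (f1 (x + e)) + complex.Re (f2 (x - e)) =
   complex.Re (P f1 x) + complex.Re (P f2 x) +
   (complex.Re ((f1 - P f1) e) + complex.Re ((f2 - P f2) (- e))).
  rewrite !dualB !linearN/= !(Lproj_ann _ Je) !linearD !linearN/=.
  rewrite -[complex.Re (P f1 x) + _]ReD -dualD PE dualD !ReD; lra.
have := Lv; rewrite LE val.
have := Re_dual_le (P f1) x1; have := Re_dual_le (P f2) x1.
have := Re_dual_le (f1 - P f1) e1.
have : rnorm (- e) <= 1 by rewrite /rnorm normrN.
move=> /(Re_dual_le (f2 - P f2)).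
have := Lproj_norm f1; have := Lproj_norm f2; lra.
Qed.

End MIdealFacts.

(** * Integrals over segments *)

Section Segment.
Context {R : realType}.
Implicit Types (f g : R -> R) (a b c d k : R).
Notation mu := (@lebesgue_measure R).

Definition seg_int a b f : R := \int[mu]_(x in `[a, b]) f x.

Definition seg_cont a b f := forall x, a <= x <= b -> {for x, continuous f}.

Lemma seg_contB a b f g :
  seg_cont a b f -> seg_cont a b g -> seg_cont a b (fun x => f x - g x).
Proof. by move=> cf cg x xab; apply: (@continuousB _ R^o R^o); [exact: cf|exact: cg]. Qed.

Lemma seg_cont_cst a b k : seg_cont a b (fun=> k).
Proof. by move=> x _; exact: cvg_cst. Qed.

Lemma seg_integrable a b f : seg_cont a b f -> mu.-integrable `[a, b] (EFin \o f).
Proof.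
move=> cf; apply: continuous_compact_integrable; first exact: segment_compact.
apply: continuous_in_subspaceT => x; rewrite inE/= in_itv/= => xab; exact: cf.
Qed.

Lemma seg_intB a b f g : seg_cont a b f -> seg_cont a b g ->
  seg_int a b (fun x => f x - g x) = seg_int a b f - seg_int a b g.
Proof. by move=> cf cg; apply: RintegralB => //; exact: seg_integrable. Qed.

Lemma seg_intD a b f g : seg_cont a b f -> seg_cont a b g ->
  seg_int a b (fun x => f x + g x) = seg_int a b f + seg_int a b g.
Proof. by move=> cf cg; apply: RintegralD => //; exact: seg_integrable. Qed.

Lemma seg_int_cst a b k : a <= b -> seg_int a b (fun=> k) = k * (b - a).
Proof.
move=> ab; rewrite /seg_int Rintegral_cst//= lebesgue_measure_itv/= lte_fin.
case: ltP => [//|ba]; have -> : a = b by apply/eqP; rewrite eq_le ab ba.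
by rewrite /= subrr.
Qed.

Lemma seg_int_le a b f g : seg_cont a b f -> seg_cont a b g ->
  (forall x, a <= x <= b -> f x <= g x) -> seg_int a b f <= seg_int a b g.
Proof.
by move=> cf cg fg; apply: le_Rintegral => //; exact: seg_integrable.
Qed.

Lemma seg_int_close a b f k d : a <= b -> seg_cont a b f ->
  (forall x, a <= x <= b -> `|f x - k| <= d) ->
  `|seg_int a b f - k * (b - a)| <= d * (b - a).
Proof.
move=> ab cf h.
have h1 := seg_int_le cf (@seg_cont_cst a b (k + d)).
have h2 := seg_int_le (@seg_cont_cst a b (k - d)) cf.
rewrite !seg_int_cst// in h1 h2.
have {}h1 : seg_int a b f <= (k + d) * (b - a).
  by apply: h1 => x /h; rewrite ler_norml => /andP[]; lra.
have {}h2 : (k - d) * (b - a) <= seg_int a b f.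
  by apply: h2 => x /h; rewrite ler_norml => /andP[]; lra.
by rewrite ler_norml; apply/andP; split; lra.
Qed.

Lemma seg_int_split a b c f : a <= b -> b <= c -> seg_cont a c f ->
  seg_int a c f = seg_int a b f + seg_int b c f.
Proof.
move=> ab bc cf; have ic := seg_integrable cf.
suff E : seg_int a c f - seg_int a b f = seg_int b c f.
  by rewrite -E addrC subrK.
rewrite /seg_int Rintegral_itvB ?bnd_simp// Rintegral_itv_obnd_cbnd//.
apply: integrableS ic => //; apply: subset_itv => //; rewrite bnd_simp//.
Qed.

End Segment.

(** * Circulation of closed forms around rectangles *)

Section Green.
Context {R : realType}.
Implicit Types (A B : R -> R -> R) (a b c d m : R).

(** First-order expansion at the point of the coefficients of [A dy + B dx].
    That the same [alpha] is the derivative of [A] in [x] and of [B] in [y] is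
    the closedness of the form; for the real and imaginary parts of a
    holomorphic function it is one of the Cauchy-Riemann equations. *)
Definition closed_form_at A B x0 y0 :=
  exists alpha beta gamma : R, forall e : R, 0 < e ->
  exists2 d : R, 0 < d & forall x y, `|x - x0| < d -> `|y - y0| < d ->
   `|A x y - A x0 y0 - (alpha * (x - x0) + beta * (y - y0))|
      <= e * (`|x - x0| + `|y - y0|) /\
   `|B x y - B x0 y0 - (gamma * (x - x0) + alpha * (y - y0))|
      <= e * (`|x - x0| + `|y - y0|).

Lemma closed_form_sym A B x0 y0 : closed_form_at A B x0 y0 ->
  closed_form_at (fun y x => B x y) (fun y x => A x y) y0 x0.
Proof.
move=> [al [be [ga h]]]; exists al, ga, be => e /h[d d0 H]; exists d => // y x yd xd.
have [] := H x y xd yd.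
by rewrite [`|y - _| + _]addrC [al * _ + be * _]addrC [ga * _ + _]addrC.
Qed.

Lemma closed_form_cont A B x0 y0 : closed_form_at A B x0 y0 ->
  {for y0, continuous (A x0)}.
Proof.
move=> [al [be [ga h]]]; have [d d0 H] := h 1 ltr01.
apply/(@cvgrPdist_le _ R^o) => e e0 /=.
have b1 : 0 < `|be| + 1 by have := normr_ge0 be; lra.
pose m := Num.min d (e / (`|be| + 1)).
have m0 : 0 < m by rewrite lt_min d0 divr_gt0.
near=> y.
have ym : `|y - y0| < m.
  near: y; exists m => //= y; rewrite /ball_/= distrC; exact.
have [yd ye] : `|y - y0| < d /\ `|y - y0| * (`|be| + 1) <= e.
  by move: ym; rewrite lt_min => /andP[-> /ltW]; rewrite ler_pdivlMr.
have xx : `|x0 - x0| < d by rewrite subrr normr0.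
have [+ _] := H x0 y xx yd.
rewrite subrr mulr0 add0r normr0 add0r mul1r => h1.
rewrite distrC; apply: le_trans ye.
rewrite mulrDr mulr1 -lerBlDl -normrM mulrC.
apply: le_trans h1; exact: lerB_dist.
Unshelve. all: by end_near. Qed.

(** The line integral of [A dy + B dx] around the rectangle, counterclockwise. *)
Definition circulation A B a b c d : R :=
  seg_int c d (fun y => A b y - A a y) - seg_int a b (fun x => B x d - B x c).

Lemma circulation_sym A B a b c d :
  circulation A B a b c d =
  - circulation (fun y x => B x y) (fun y x => A x y) c d a b.
Proof. by rewrite /circulation opprB. Qed.

Definition closed_on A B a b c d :=
  forall x y, a <= x <= b -> c <= y <= d -> closed_form_at A B x y.

Lemma closed_onS A B a b c d a' b' c' d' : a <= a' -> b' <= b -> c <= c' -> d' <= d ->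
  closed_on A B a b c d -> closed_on A B a' b' c' d'.
Proof.
move=> aa bb cc dd h x y /andP[ax xb] /andP[cy yd]; apply: h.
  by rewrite (le_trans aa ax) (le_trans xb bb).
by rewrite (le_trans cc cy) (le_trans yd dd).
Qed.

Lemma circulation_splitx A B a m b c d : a <= m -> m <= b -> c <= d ->
  closed_on A B a b c d ->
  circulation A B a b c d = circulation A B a m c d + circulation A B m b c d.
Proof.
move=> am mb cd h; rewrite /circulation.
have cA x : a <= x <= b -> seg_cont c d (A x).
  by move=> xab y ycd; exact: closed_form_cont (h _ _ xab ycd).
have cB y : c <= y <= d -> seg_cont a b (fun x => B x y).
  by move=> ycd x xab; exact: closed_form_cont (closed_form_sym (h _ _ xab ycd)).
have [ha hm hb] : [/\ a <= a <= b, a <= m <= b & a <= b <= b].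
  by rewrite !lexx am mb (le_trans am mb).
have [hc hd] : c <= c <= d /\ c <= d <= d by rewrite !lexx cd.
rewrite (seg_int_split am mb); last exact: (seg_contB (cB _ hd) (cB _ hc)).
have -> : seg_int c d (fun y => A b y - A a y) =
  seg_int c d (fun y => A m y - A a y) + seg_int c d (fun y => A b y - A m y).
  rewrite -seg_intD; try by apply: seg_contB; exact: cA.
  by congr seg_int; apply/funext => y; ring.
ring.
Qed.

Lemma circulation_splity A B a b c m d : a <= b -> c <= m -> m <= d ->
  closed_on A B a b c d ->
  circulation A B a b c d = circulation A B a b c m + circulation A B a b m d.
Proof.
move=> ab cm md h.
rewrite circulation_sym (circulation_splitx cm md ab); last first.
  by move=> y x ycd xab; exact: closed_form_sym (h _ _ xab ycd).
by rewrite opprD -!circulation_sym.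
Qed.

(** The affine parts of the coefficients have no circulation, because the form
    is closed; the remainders are at most [e] times the perimeter, on a contour
    of comparable length. *)
Lemma circulation_small A B x0 y0 (e : R) : closed_form_at A B x0 y0 -> 0 < e ->
  exists2 r : R, 0 < r & forall a b c d, a <= x0 <= b -> c <= y0 <= d ->
    b - a < r -> d - c < r -> closed_on A B a b c d ->
    `|circulation A B a b c d| <= e * ((b - a) + (d - c)) ^+ 2.
Proof.
move=> [al [be [ga h]]] e0; have [|r r0 H] := h (e / 2); first by rewrite divr_gt0.
exists r => // a b c d /andP[ax xb] /andP[cy yd] abr cdr hcl.
have [ab cd] := (le_trans ax xb, le_trans cy yd).
have dx x : a <= x <= b -> `|x - x0| <= b - a by move=> /andP[? ?]; rewrite ler_norml; lra.
have dy y : c <= y <= d -> `|y - y0| <= d - c by move=> /andP[? ?]; rewrite ler_norml; lra.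
have [ha hb] : a <= a <= b /\ a <= b <= b by rewrite !lexx ab.
have [hc hd] : c <= c <= d /\ c <= d <= d by rewrite !lexx cd.
have cA x : a <= x <= b -> seg_cont c d (A x).
  by move=> xab y ycd; exact: closed_form_cont (hcl _ _ xab ycd).
have cB y : c <= y <= d -> seg_cont a b (fun x => B x y).
  by move=> ycd x xab; exact: closed_form_cont (closed_form_sym (hcl _ _ xab ycd)).
set w := b - a in abr *; set k := d - c in cdr *.
have H' x y : a <= x <= b -> c <= y <= d ->
    `|A x y - A x0 y0 - (al * (x - x0) + be * (y - y0))| <= e / 2 * (w + k) /\
    `|B x y - B x0 y0 - (ga * (x - x0) + al * (y - y0))| <= e / 2 * (w + k).
  move=> xab ycd; have [H1 H2] := H x y (le_lt_trans (dx _ xab) abr) (le_lt_trans (dy _ ycd) cdr).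
  have E : e / 2 * (`|x - x0| + `|y - y0|) <= e / 2 * (w + k).
    by apply: ler_wpM2l; [lra|apply: lerD; [exact: dx|exact: dy]].
  by split; [apply: le_trans H1 E|apply: le_trans H2 E].
have I1 : `|seg_int c d (fun y => A b y - A a y) - al * w * k| <= e * (w + k) * k.
  apply: seg_int_close => //; first by apply: seg_contB; exact: cA.
  move=> y ycd; have [+ _] := H' _ _ ha ycd; have [+ _] := H' _ _ hb ycd.
  rewrite !ler_norml /w => /andP[? ?] /andP[? ?]; apply/andP; split; lra.
have I2 : `|seg_int a b (fun x => B x d - B x c) - al * k * w| <= e * (w + k) * w.
  apply: seg_int_close => //; first by apply: seg_contB; exact: cB.
  move=> x xab; have [_ +] := H' _ _ xab hc; have [_ +] := H' _ _ xab hd.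
  rewrite !ler_norml /k => /andP[? ?] /andP[? ?]; apply/andP; split; lra.
rewrite /circulation; move: I1 I2; move: (seg_int _ _ _) (seg_int _ _ _) => S T.
rewrite !ler_norml => /andP[? ?] /andP[? ?].
have -> : e * (w + k) ^+ 2 = e * (w + k) * k + e * (w + k) * w by ring.
have : al * w * k = al * k * w by ring.
lra.
Qed.

End Green.

(** * Goursat's theorem *)

Section Goursat.
Context {R : realType}.
Implicit Types (A B : R -> R -> R) (a b c d : R).

(** The circulation is the sum of those around the four quarters, hence one of
    these is at least as large as the average. *)
Lemma circulation_quarter A B x y w h (Z : R) : 0 <= w -> 0 <= h ->
  closed_on A B x (x + w + w) y (y + h + h) ->
  4 * Z <= `|circulation A B x (x + w + w) y (y + h + h)| ->
  exists x' y', [/\ x <= x' <= x + w, y <= y' <= y + h &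
    Z <= `|circulation A B x' (x' + w) y' (y' + h)|].
Proof.
move=> w0 h0 hcl.
have [xw xw'] : x <= x + w /\ x + w <= x + w + w by split; lra.
have [yh yh'] : y <= y + h /\ y + h <= y + h + h by split; lra.
rewrite (circulation_splitx xw xw' (le_trans yh yh') hcl).
rewrite (circulation_splity xw yh yh'); last exact: closed_onS hcl.
rewrite (circulation_splity xw' yh yh'); last exact: closed_onS hcl.
set C1 := circulation _ _ x _ y _; set C2 := circulation _ _ x _ (y + h) _.
set C3 := circulation _ _ (x + w) _ y _; set C4 := circulation _ _ (x + w) _ (y + h) _.
move=> pE.
have [h1|h1] := leP Z `|C1|; first by exists x, y; rewrite !lexx xw yh.
have [h2|h2] := leP Z `|C2|; first by exists x, (y + h); rewrite !lexx xw yh.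
have [h3|h3] := leP Z `|C3|; first by exists (x + w), y; rewrite !lexx xw yh.
have [h4|h4] := leP Z `|C4|; first by exists (x + w), (y + h); rewrite !lexx xw yh.
exfalso; clear hcl xw xw' yh yh' w0 h0.
have t3 := ler_normD (C1 + C2) (C3 + C4); have t1 := ler_normD C1 C2.
have t2 := ler_normD C3 C4; clearbody C1 C2 C3 C4; lra.
Qed.

(** Goursat's bisection: passing repeatedly to the worst quarter gives nested
    rectangles whose circulation decreases no faster than their squared
    diameter, while near their common point the circulation is negligible with
    respect to it. *)
Lemma goursat A B a b c d : a <= b -> c <= d -> closed_on A B a b c d ->
  circulation A B a b c d = 0.
Proof.
move=> ab cd hcl; apply/eqP/negPn/negP => C0.
pose E := `|circulation A B a b c d|.
have E0 : 0 < E by rewrite normr_gt0.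
pose q k : R := 2^-1 ^+ k.
have q0 k : 0 < q k by rewrite exprn_gt0// invr_gt0.
have qS k : q k = q k.+1 + q k.+1 by rewrite /q exprS; lra.
pose W := b - a; pose H := d - c.
have W0 : 0 <= W by rewrite subr_ge0.
have H0 : 0 <= H by rewrite subr_ge0.
pose bad k (p : R * R) :=
  [/\ a <= p.1, p.1 + W * q k <= b, c <= p.2, p.2 + H * q k <= d &
   E * q k ^+ 2 <= `|circulation A B p.1 (p.1 + W * q k) p.2 (p.2 + H * q k)|].
pose sub k (p p' : R * R) :=
  [/\ p.1 <= p'.1, p'.1 + W * q k.+1 <= p.1 + W * q k,
      p.2 <= p'.2 & p'.2 + H * q k.+1 <= p.2 + H * q k].
have step k p : bad k p -> exists p', bad k.+1 p' /\ sub k p p'.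
  move=> [pa pb pc pd pE].
  have wE : W * q k = W * q k.+1 + W * q k.+1 by rewrite qS mulrDr.
  have hE : H * q k = H * q k.+1 + H * q k.+1 by rewrite qS mulrDr.
  have qE : E * q k ^+ 2 = 4 * (E * q k.+1 ^+ 2) by rewrite (qS k); ring.
  rewrite wE hE qE !addrA in pb pd pE.
  have [|||x' [y' [/andP[h1 h2] /andP[h3 h4] h5]]] := circulation_quarter _ _ _ pE.
  - by rewrite mulr_ge0// ltW.
  - by rewrite mulr_ge0// ltW.
  - exact: closed_onS hcl.
  have g1 : x' + W * q k.+1 <= p.1 + W * q k by rewrite wE addrA lerD2r.
  have g2 : y' + H * q k.+1 <= p.2 + H * q k by rewrite hE addrA lerD2r.
  exists (x', y'); split; split => //=.
  - exact: le_trans pa h1.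
  - by apply: le_trans pb; rewrite -addrA -wE.
  - exact: le_trans pc h3.
  - by apply: le_trans pd; rewrite -addrA -hE.
have /choice[F HF] (x : nat * (R * R)) :
    exists y, bad x.1 x.2 -> bad x.1.+1 y /\ sub x.1 x.2 y.
  by have [/step[y hy]|nb] := pselect (bad x.1 x.2); [exists y|exists x.2].
pose s := fix s k := if k is k'.+1 then F (k', s k') else (a, c).
have sbad k : bad k (s k).
  elim: k => [|k /(HF (k, _))[]//].
  rewrite /bad /q /W /H /= !expr0 expr1n !mulr1 !lexx; split=> //; try lra.
  by have [-> ->] : a + (b - a) = b /\ c + (d - c) = d by split; ring.
have ssub k : sub k (s k) (s k.+1) by have [] := HF (k, s k) (sbad k).
have mono k m : (k <= m)%N -> [/\ (s k).1 <= (s m).1,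
    (s m).1 + W * q m <= (s k).1 + W * q k, (s k).2 <= (s m).2 &
    (s m).2 + H * q m <= (s k).2 + H * q k].
  elim: m => [|m IH]; first by rewrite leqn0 => /eqP ->.
  rewrite leq_eqVlt => /predU1P[->//|]; rewrite ltnS => /IH[h1 h2 h3 h4].
  have [g1 g2 g3 g4] := ssub m; split.
  - exact: le_trans h1 g1.
  - exact: le_trans g2 h2.
  - exact: le_trans h3 g3.
  - exact: le_trans g4 h4.
have lim (u : nat -> R) (K : R) : 0 <= K ->
    (forall k m, (k <= m)%N -> u k <= u m /\ u m + K * q m <= u k + K * q k) ->
    exists x, forall k, u k <= x <= u k + K * q k.
  move=> K0 hu.
  have ub k m : u m <= u k + K * q k.
    have [km|/ltnW mk] := leqP k m.
      have [_ h] := hu _ _ km; apply: le_trans h; rewrite lerDl mulr_ge0// ltW//.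
    have [h _] := hu _ _ mk; apply: (le_trans h); rewrite lerDl mulr_ge0// ltW//.
  have hs : has_sup (range u).
    by split; [exists (u 0%N), 0%N|exists (u 0%N + K * q 0%N) => _ [m _ <-]].
  exists (sup (range u)) => k; apply/andP; split.
    by apply: sup_upper_bound => //; exists k.
  by apply: sup_le_ub; [exists (u 0%N), 0%N|move=> _ [m _ <-]].
have [x0 hx0] := lim (fun k => (s k).1) W W0 (fun k m km =>
  let: And4 h1 h2 _ _ := mono k m km in conj h1 h2).
have [y0 hy0] := lim (fun k => (s k).2) H H0 (fun k m km =>
  let: And4 _ _ h1 h2 := mono k m km in conj h1 h2).
have cl0 : closed_form_at A B x0 y0.
  apply: hcl.
    by have := hx0 0%N; rewrite /q expr0 mulr1 /W /=; lra.
  by have := hy0 0%N; rewrite /q expr0 mulr1 /H /=; lra.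
(* Small enough for the k-th rectangle, of half-perimeter [(W + H) * q k], to
   have circulation less than [E * q k ^+ 2]. *)
have e0 : 0 < E / (2 * ((W + H) ^+ 2 + 1)).
  by rewrite divr_gt0// mulr_gt0// ltr_wpDl// sqr_ge0.
have [r r0 small] := circulation_small cl0 e0.
have [k kr] : exists k, (W + H + 1) * q k < r.
  have r'0 : 0 < r / (W + H + 1) by rewrite divr_gt0//; lra.
  have : (fun n => (2^-1 : R) ^+ n) @ \oo --> (0 : R).
    by apply: cvg_expr; rewrite ger0_norm ?invr_ge0// invf_lt1// ltr1n.
  move=> /(@cvgrPdist_lt _ R^o) /(_ _ r'0)[k _ /(_ k (leqnn k))].
  rewrite sub0r normrN ger0_norm ?ltW ?q0// => h; exists k.
  by rewrite mulrC -ltr_pdivlMr//; lra.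
have Wq : W * q k < r.
  by apply: le_lt_trans kr; rewrite ler_wpM2r ?ltW//; lra.
have Hq : H * q k < r.
  by apply: le_lt_trans kr; rewrite ler_wpM2r ?ltW//; lra.
have [pa pb pc pd pE] := sbad k.
have := small _ _ _ _ (hx0 k) (hy0 k).
have e1 : (s k).1 + W * q k - (s k).1 = W * q k by ring.
have e2 : (s k).2 + H * q k - (s k).2 = H * q k by ring.
rewrite e1 e2 => /(_ Wq Hq (closed_onS pa pb pc pd hcl)).
move=> /(le_trans pE).
set T := (W + H) ^+ 2 in e0 *; have T0 : 0 <= T by rewrite sqr_ge0.
have -> : E / (2 * (T + 1)) * (W * q k + H * q k) ^+ 2 =
    E * (T / (2 * (T + 1))) * q k ^+ 2.
  rewrite /T; field; rewrite -/T; lra.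
rewrite ler_pM2r ?exprn_gt0// leNgt => /negP; apply.
by rewrite -[ltRHS]mulr1 ltr_pM2l// ltr_pdivrMr; lra.
Qed.

End Goursat.

(** * Circular means of holomorphic functions *)

Section ComplexDerivative.
Context {R : realType}.
Implicit Types (G : R[i] -> R[i]) (w h D : R[i]).

Lemma le_normcB w h : normc w - normc h <= normc (w - h).
Proof. by rewrite lerBlDr (le_trans _ (le_normcD _ _))// subrK. Qed.

Lemma normc_le_ReIm w : normc w <= `|complex.Re w| + `|complex.Im w|.
Proof.
rewrite -[leLHS]ger0_norm ?normc_ge0// -ler_sqr ?nnegrE ?addr_ge0//.
rewrite ger0_norm ?normc_ge0// normc_sqr.
rewrite -(real_normK (num_real (complex.Re w))) -(real_normK (num_real (complex.Im w))).
by rewrite sqrrD lerD2r lerDl mulrn_wge0// mulr_ge0.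
Qed.

Lemma Re_norm_le w : `|complex.Re w| <= normc w.
Proof.
by rewrite ler_norml Re_le_normc andbT lerNl -ReN -normcN Re_le_normc.
Qed.

Lemma Im_norm_le w : `|complex.Im w| <= normc w.
Proof.
case: w => a b /=; rewrite -sqrtr_sqr ler_wsqrtr// lerDr sqr_ge0 //.
Qed.

Lemma gt0_cplx (d : R[i]) : 0 < d -> d = (complex.Re d)%:C /\ 0 < complex.Re d.
Proof. by case: d => a b; rewrite ltcE/= => /andP[/eqP -> ->]. Qed.

Lemma normc_lt_cplx w (d : R) : (`|w| < d%:C) = (normc w < d).
Proof. exact: ltcR. Qed.

(** Moduli and radii are real here, while norms over [R[i]] are complex
    numbers. *)
Definition cdiff G w D := forall e : R, 0 < e -> exists2 d : R, 0 < d &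
  forall h, normc h < d -> normc (G (w + h) - G w - D * h) <= e * normc h.

Lemma cdiffP G w : differentiable G w <-> exists D, cdiff G w D.
Proof.
rewrite -derivable1_diffP; split.
  move=> /cvg_ex[D /(@cvgrPdist_le _ R[i]) H]; exists D => e e0.
  have eC : 0 < e%:C :> R[i] by rewrite ltcR.
  have /nbhs_ballP[d /= /gt0_cplx[-> d0] Hd] := H _ eC.
  exists (complex.Re d) => // h hd.
  have [->|h0] := eqVneq h 0; first by rewrite addr0 subrr mulr0 subr0 normc0 mulr0.
  have := Hd h; rewrite /ball/= sub0r normrN normc_lt_cplx => /(_ hd h0).
  rewrite -[h *: 1]/(h * 1) mulr1 normCE lecR => le.
  have -> : G (w + h) - G w - D * h = - ((D - h^-1 * (G (h + w) - G w)) * h).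
    by rewrite [w + h]addrC; field.
  by rewrite normcN normcM ler_wpM2r ?normc_ge0.
move=> [D H]; apply/cvg_ex; exists D; apply/(@cvgrPdist_le _ R[i]) => e /gt0_cplx[-> e0].
have [d d0 Hd] := H _ e0.
apply/nbhs_ballP; exists d%:C; first by rewrite /= ltcR.
move=> h; rewrite /ball/= sub0r normrN normc_lt_cplx => hd h0.
have := Hd h hd; rewrite -[h *: 1]/(h * 1) mulr1 normCE lecR => le.
have hn : 0 < normc h.
  by rewrite lt_neqAle normc_ge0 andbT eq_sym; apply: contra h0 => /eqP/eq0_normc ->.
rewrite -(ler_pM2r hn) -normcM; apply: le_trans le; rewrite -normcN.
rewrite le_eqVlt; apply/orP; left; apply/eqP; congr normc.
by rewrite -[h^-1 *: _]/(h^-1 * _) [w + h]addrC; field.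
Qed.

Lemma cdiff_closed_form G x0 y0 : differentiable G (x0 +i* y0) ->
  closed_form_at (fun x y => complex.Re (G (x +i* y)))
                 (fun x y => complex.Im (G (x +i* y))) x0 y0.
Proof.
move=> /cdiffP[D H]; exists (complex.Re D), (- complex.Im D), (complex.Im D) => e e0.
have [d d0 Hd] := H e e0; exists (d / 2); first by rewrite divr_gt0.
move=> x y xd yd; set h := (x - x0) +i* (y - y0).
have hle : normc h <= `|x - x0| + `|y - y0| := normc_le_ReIm h.
have hd : normc h < d by apply: (le_lt_trans hle); lra.
have wh : x0 +i* y0 + h = x +i* y.
  by apply/eqP; rewrite eq_complex/=; apply/andP; split; apply/eqP; ring.
have := Hd h hd; rewrite wh => le.
have {}le : normc (G (x +i* y) - G (x0 +i* y0) - D * h) <= e * (`|x - x0| + `|y - y0|).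
  by apply: (le_trans le); rewrite ler_pM2l.
split.
  apply: le_trans le; apply: le_trans (Re_norm_le _).
  rewrite le_eqVlt; apply/orP; left; apply/eqP; congr `|_|.
  rewrite /h; case: (G (x +i* y)) (G (x0 +i* y0)) D {H Hd} => [a b] [a' b'] [u v] /=; ring.
apply: le_trans le; apply: le_trans (Im_norm_le _).
rewrite le_eqVlt; apply/orP; left; apply/eqP; congr `|_|.
rewrite /h; case: (G (x +i* y)) (G (x0 +i* y0)) D {H Hd} => [a b] [a' b'] [u v] /=; ring.
Qed.

Lemma normc_conj w : normc w^* = normc w.
Proof. by case: w => a b /=; rewrite sqrrN. Qed.

(** The Schwarz reflection in the line of real part [l / 2]. *)
Lemma differentiable_reflection G (l : R) w : differentiable G (l%:C - w^*) ->
  differentiable (fun u => (G (l%:C - u^*))^*) w.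
Proof.
move=> /cdiffP[D H]; apply/cdiffP; exists (- D^*) => e e0.
have [d d0 Hd] := H e e0; exists d => // h hd.
have := Hd (- h^*); rewrite normcN normc_conj => /(_ hd) le.
have -> : l%:C - (w + h)^* = l%:C - w^* + - h^* by rewrite rmorphD/= opprD addrA.
apply: le_trans le; rewrite -[leRHS]normc_conj.
rewrite !rmorphB/= rmorphM/= rmorphN/= conjcK.
by rewrite le_eqVlt; apply/orP; left; apply/eqP; congr normc; ring.
Qed.

Definition Cexp w : R[i] :=
  (expR (complex.Re w) * cos (complex.Im w)) +i*
  (expR (complex.Re w) * sin (complex.Im w)).

Lemma CexpD w h : Cexp (w + h) = Cexp w * Cexp h.
Proof.
case: w h => [a b] [c d]; rewrite /Cexp/= expRD cosD sinD.
by apply/eqP; rewrite eq_complex/=; apply/andP; split; apply/eqP; ring.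
Qed.

Lemma normc_Cexp w : normc (Cexp w) = expR (complex.Re w).
Proof.
by rewrite /Cexp/= !exprMn -mulrDr cos2Dsin2 mulr1 sqrtr_sqr ger0_norm//.
Qed.

Lemma real_taylor1 (f : R -> R) (c : R) : is_derive (0 : R) 1 f c ->
  forall e : R, 0 < e -> exists2 d : R, 0 < d &
  forall h : R, `|h| < d -> `|f h - f 0 - c * h| <= e * `|h|.
Proof.
move=> [df fc] e e0; move: df => /cvg_ex[c' H].
have cc : c' = c by rewrite -fc; apply/esym; exact: cvg_lim H.
move: H; rewrite {}cc => /(@cvgrPdist_le _ R^o)/(_ e e0)/nbhs_ballP[d /= d0 Hd].
exists d => // h hd; have [->|h0] := eqVneq h 0.
  by rewrite subrr mulr0 subr0 normr0 mulr0.
have := Hd h; rewrite /ball/= sub0r normrN => /(_ hd h0).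
rewrite -[h *: 1]/(h * 1) mulr1 addr0 => le.
have -> : f h - f 0 - c * h = - ((c - h^-1 * (f h - f 0)) * h) by field.
by rewrite normrN normrM ler_wpM2r.
Qed.

Lemma differentiable_Cexp w : differentiable Cexp w.
Proof.
apply/cdiffP; exists (Cexp w) => e e0.
suff [d d0 Hd] : exists2 d : R, 0 < d &
    forall h, normc h < d -> normc (Cexp h - 1 - h) <= e / (normc (Cexp w)) * normc h.
  exists d => // h /Hd le; have -> : Cexp (w + h) - Cexp w - Cexp w * h =
    Cexp w * (Cexp h - 1 - h) by rewrite CexpD; ring.
  rewrite normcM mulrC -ler_pdivlMr ?normc_Cexp ?expR_gt0//.
  by rewrite mulrAC -normc_Cexp.
have : 0 < e / normc (Cexp w) by rewrite divr_gt0// normc_Cexp expR_gt0.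
move: (e / _) => {e0}e e0.
have [k k0 [ke k1]] : exists2 k : R, 0 < k & k <= e / 12 /\ k <= 1.
  exists (Num.min (e / 12) 1); first by rewrite lt_min ltr01 divr_gt0.
  by rewrite !ge_min !lexx !orbT.
have [d1 d10 H1] := @real_taylor1 expR 1 (is_derive_eq (is_derive_expR 0) (expR0 R)) k k0.
have [d2 d20 H2] := @real_taylor1 cos 0 (is_derive_eq (is_derive_cos 0)
   (etrans (congr1 -%R (sin0 R)) (oppr0 R))) k k0.
have [d3 d30 H3] := @real_taylor1 sin 1 (is_derive_eq (is_derive_sin 0) (cos0 R)) k k0.
exists (Num.min (Num.min d1 d2) (Num.min d3 k)).
  by rewrite !lt_min d10 d20 d30 k0.
move=> h; rewrite !lt_min => /andP[/andP[hd1 hd2] /andP[hd3 hk]].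
set N := normc h in hd1 hd2 hd3 hk *.
have N0 : 0 <= N by exact: normc_ge0.
have hx := Re_norm_le h; have hy := Im_norm_le h.
have := H1 _ (le_lt_trans hx hd1); have := H2 _ (le_lt_trans hy hd2).
have := H3 _ (le_lt_trans hy hd3).
rewrite expR0 cos0 sin0 subr0 mul0r subr0 !mul1r.
rewrite -/N in hx hy.
have ReE : complex.Re (Cexp h - 1 - h) =
    expR (complex.Re h) * cos (complex.Im h) - 1 - complex.Re h by case: (h).
have ImE : complex.Im (Cexp h - 1 - h) =
    expR (complex.Re h) * sin (complex.Im h) - 0 - complex.Im h by case: (h).
set x := complex.Re h in ReE ImE hx *; set y := complex.Im h in ReE ImE hy *.
set E := expR x in ReE ImE *; set c := cos y in ReE *; set s := sin y in ImE *.
move=> hs hc hE.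
have kk (u : R) : `|u| <= N -> k * `|u| <= k * N by move=> ?; rewrite ler_pM2l.
have {}hs := le_trans hs (kk _ hy); have {}hc := le_trans hc (kk _ hy).
have {}hE := le_trans hE (kk _ hx).
apply: (le_trans (normc_le_ReIm _)); rewrite ReE ImE.
have -> : E * c - 1 - x = (E - 1 - x) * c + (1 + x) * (c - 1) by ring.
have -> : E * s - 0 - y = (E - 1 - x) * s + (1 + x) * (s - y) + x * y by ring.
have c1 : `|c| <= 1 by rewrite ler_norml cos_geN1 cos_le1.
have s1 : `|s| <= 1 by rewrite ler_norml sin_geN1 sin_le1.
have x2 : `|1 + x| <= 2 by apply: (le_trans (ler_normD _ _)); rewrite normr1; lra.
have kN : 0 <= k * N by rewrite mulr_ge0// ltW.
have t1 : `|(E - 1 - x) * c| <= k * N.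
  by rewrite normrM -[leRHS]mulr1 ler_pM.
have t2 : `|(1 + x) * (c - 1)| <= 2 * (k * N) by rewrite normrM ler_pM.
have t3 : `|(E - 1 - x) * s| <= k * N by rewrite normrM -[leRHS]mulr1 ler_pM.
have t4 : `|(1 + x) * (s - y)| <= 2 * (k * N) by rewrite normrM ler_pM.
have t5 : `|x * y| <= k * N.
  by rewrite normrM ler_pM// (le_trans hx)// ltW.
have : k * N <= e / 12 * N by rewrite ler_wpM2r.
have := ler_normD ((E - 1 - x) * c) ((1 + x) * (c - 1)).
have := ler_normD ((E - 1 - x) * s) ((1 + x) * (s - y)).
have := ler_normD ((E - 1 - x) * s + (1 + x) * (s - y)) (x * y).
have eN : 0 <= e * N by rewrite mulr_ge0// ltW.
move: t1 t2 t3 t4 t5 eN; clear; lra.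
Qed.

Lemma Cexp_2pi w : Cexp (w + (0 +i* (2 * pi))) = Cexp w.
Proof.
rewrite CexpD /Cexp/= expR0 mulr_natl cos2pi sin2pi !mul1r.
have -> : 1 +i* 0 = 1 :> R[i] by [].
by rewrite mulr1.
Qed.

(** In logarithmic coordinates circles about 0 are vertical segments of length
    [2 pi].  By periodicity the horizontal sides of the rectangle between two of
    them cancel, so the vertical ones have equal integrals. *)
Lemma circle_mean_strip G (s t : R) : s <= t ->
  (forall w, s <= complex.Re w <= t -> differentiable G w) ->
  (forall w, G (w + (0 +i* (2 * pi))) = G w) ->
  seg_int 0 (2 * pi) (fun y => complex.Re (G (s +i* y))) =
  seg_int 0 (2 * pi) (fun y => complex.Re (G (t +i* y))).
Proof.
move=> st dG pG.
pose A x y := complex.Re (G (x +i* y)); pose B x y := complex.Im (G (x +i* y)).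
have p0 : 0 <= 2 * pi :> R by rewrite mulr_ge0// pi_ge0.
have cl : closed_on A B s t 0 (2 * pi).
  by move=> x y xst _; apply: cdiff_closed_form; exact: dG.
have := goursat st p0 cl; rewrite /circulation.
have -> : (fun x => B x (2 * pi) - B x 0) = fun=> 0.
  apply/funext => x; apply/eqP; rewrite subr_eq0 /B -(pG (x +i* 0)).
  have -> : x +i* 0 + (0 +i* (2 * pi)) = x +i* (2 * pi) :> R[i].
    by apply/eqP; rewrite eq_complex/= addr0 add0r !eqxx.
  by [].
rewrite seg_int_cst// mul0r subr0.
have cA x : s <= x <= t -> seg_cont 0 (2 * pi) (A x).
  by move=> xst y y02; exact: closed_form_cont (cl x y xst y02).
rewrite seg_intB; [|by apply: cA; rewrite lexx st..].
by move=> /eqP; rewrite subr_eq0 => /eqP.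
Qed.

End ComplexDerivative.

(** * Harnack's inequality *)

Section Harnack.
Context {R : realType}.
Implicit Types (K k : R[i] -> R[i]).

Lemma differentiable_seg_cont (K : R[i] -> R[i]) (s c d : R) :
  (forall y, differentiable K (s +i* y)) ->
  seg_cont c d (fun y => complex.Re (K (s +i* y))).
Proof.
move=> dK y _.
exact: (closed_form_cont (cdiff_closed_form (dK y))).
Qed.

(** The circular means do not depend on the radius, and as the radius shrinks
    they tend to the value at the singularity. *)
Lemma circle_mean_puncture K (L : R[i]) (rho s : R) :
  (forall u, 0 < normc u < rho -> differentiable K u) ->
  (forall e : R, 0 < e -> exists2 d : R, 0 < d &
     forall u, 0 < normc u < d -> normc (K u - L) <= e) ->
  expR s < rho ->
  seg_int 0 (2 * pi) (fun y => complex.Re (K (Cexp (s +i* y)))) =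
  2 * pi * complex.Re L.
Proof.
move=> dK KL sr; have p0 : 0 < 2 * pi :> R by rewrite mulr_gt0// pi_gt0.
pose G w := K (Cexp w).
have dG w : complex.Re w <= s -> differentiable G w.
  move=> ws; apply: differentiable_comp; first exact: differentiable_Cexp.
  by apply: dK; rewrite normc_Cexp expR_gt0/= (le_lt_trans _ sr)// ler_expR.
apply/eqP; rewrite -subr_eq0 -normr_le0; apply/ler_addgt0Pl => e e0; rewrite addr0.
have [|d d0 Hd] := KL (e / (2 * pi)); first by rewrite divr_gt0.
pose t := Num.min s (ln (d / 2)).
have ts : t <= s by rewrite ge_min lexx.
have td : expR t < d.
  have : t <= ln (d / 2) by rewrite ge_min lexx orbT.
  rewrite -ler_expR lnK ?posrE ?divr_gt0//; lra.
have <- : seg_int 0 (2 * pi) (fun y => complex.Re (G (t +i* y))) =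
    seg_int 0 (2 * pi) (fun y => complex.Re (K (Cexp (s +i* y)))).
  apply: circle_mean_strip => //; first by move=> w /andP[_ ?]; exact: dG.
  by move=> w; rewrite /G Cexp_2pi.
have -> : 2 * pi * complex.Re L = complex.Re L * (2 * pi - 0) by ring.
have -> : e = e / (2 * pi) * (2 * pi - 0) by rewrite subr0 mulfVK// gt_eqF.
apply: seg_int_close; first exact: ltW.
  by apply: differentiable_seg_cont => y; exact: dG.
move=> y _; rewrite -ReB; apply: (le_trans (Re_norm_le _)); apply: Hd.
by rewrite normc_Cexp expR_gt0.
Qed.

Lemma normc_le2 (a b : R[i]) (x y : R) : normc a <= x -> normc b <= y ->
  normc (a + b) <= x + y.
Proof. by move=> ax bx; rewrite (le_trans (le_normcD _ _))// lerD. Qed.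

(** Testing [k] on the circle of radius [r] against [2 + 2 cos y], which is
    [2 + u / r + r / u] there, gives twice the value plus [r] times the
    derivative at the centre, with a nonnegative real part since both factors
    have one. *)
Lemma Re_derivative_ge k (D : R[i]) (rho r : R) : 0 < r -> r < rho ->
  (forall u, normc u < rho -> differentiable k u) -> cdiff k 0 D ->
  (forall u, normc u < rho -> 0 <= complex.Re (k u)) ->
  - 2 * complex.Re (k 0) <= r * complex.Re D.
Proof.
move=> r0 rrho dk kD k0.
have rho0 : 0 < rho := lt_trans r0 rrho.
have rC : r%:C != 0 by apply/eqP => /(@complexI R); apply/eqP; rewrite gt_eqF.
pose kap := complex.Re (k 0).
(* Subtracting [k 0] makes the singularity at 0 removable, with value [r * D];
   the last summand cancels the term [2 * kap * cos y] that this creates. *)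
pose K u := (k u - k 0) * (2 + u / r%:C + r%:C / u) + (2 * kap / r)%:C * u.
have du (u : R[i]) : differentiable (fun u : R[i] => u) u by exact: ex_diff.
have dc (c u : R[i]) : differentiable (fun _ : R[i] => c) u by exact: differentiable_cst.
have dK u : 0 < normc u < rho -> differentiable K u.
  move=> /andP[u0 ur].
  have u1 : u != 0 by apply/eqP => E; rewrite E normc0 ltxx in u0.
  apply: differentiableD; last by apply: differentiableM.
  apply: differentiableM; first by apply: differentiableB => //; exact: dk.
  apply: differentiableD; first by apply: differentiableD => //; exact: differentiableM.
  by apply: differentiableM => //; exact: differentiableV.
have KL (e : R) : 0 < e -> exists2 d : R, 0 < d &
     forall u, 0 < normc u < d -> normc (K u - r%:C * D) <= e.
  move=> e0.
  pose B := (normc D + 1) * (2 + r^-1) + `|2 * kap / r|.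
  have B0 : 0 < B + 1.
    have := normc_ge0 D; have : 0 <= r^-1 by rewrite invr_ge0 ltW.
    by move=> h1 h2; rewrite ltr_wpDl// addr_ge0// mulr_ge0//; lra.
  have [|d d0 Hd] := kD (e / (2 * r)); first by rewrite divr_gt0// mulr_gt0.
  have [d' d'0 Hd'] := kD 1 ltr01.
  exists (Num.min (Num.min d d') (Num.min 1 (e / (2 * (B + 1))))).
    by rewrite !lt_min d0 d'0 ltr01 divr_gt0// mulr_gt0.
  move=> u /andP[u0]; rewrite !lt_min => /andP[/andP[ud ud'] /andP[u1 ue]].
  have un0 : u != 0 by apply/eqP => E; rewrite E normc0 ltxx in u0.
  have := Hd _ ud; have := Hd' _ ud'; rewrite add0r mul1r.
  set q := k u - k 0 => h' h.
  have nq : normc q <= (normc D + 1) * normc u.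
    have -> : q = (q - D * u) + D * u by ring.
    apply: (le_trans (normc_le2 h' (lexx _))); rewrite normcM; lra.
  have -> : K u - r%:C * D = (q - D * u) * (r%:C / u) +
      (q * (2 + u / r%:C) + (2 * kap / r)%:C * u).
    by rewrite /K -/q; field; apply/andP; split; [exact: rC|exact: un0].
  have e2 : e = e / 2 + e / 2 by lra.
  rewrite {}e2; apply: normc_le2.
    rewrite normcM normcM normcV normc_real gtr0_norm//.
    rewrite mulrA ler_pdivrMr// -ler_pdivlMr//.
    apply: (le_trans h); rewrite le_eqVlt; apply/orP; left; apply/eqP.
    by field; rewrite gt_eqF.
  have n2 : normc (2 + u / r%:C) <= 2 + r^-1.
    apply: normc_le2.
      by rewrite -[2]/(2%:R) -(rmorph_nat (real_complex R)) normc_real normr_nat.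
    rewrite normcM normcV normc_real gtr0_norm// ler_piMl// ?invr_ge0 ltW//.
  have : normc (q * (2 + u / r%:C) + (2 * kap / r)%:C * u) <= B * normc u.
    rewrite (_ : B * normc u = (normc D + 1) * (2 + r^-1) * normc u +
      `|2 * kap / r| * normc u); last by rewrite /B; ring.
    apply: normc_le2; last by rewrite normcM normc_real.
    by rewrite normcM mulrAC ler_pM ?normc_ge0.
  move=> /le_trans; apply; move: ue; rewrite invfM mulrA ltr_pdivlMr// => ue.
  by apply: le_trans (ltW ue); rewrite mulrC ler_wpM2l ?normc_ge0//; lra.
have := circle_mean_puncture (s := ln r) dK KL; rewrite lnK ?posrE// => /(_ rrho) E.
have p0 : 0 < 2 * pi :> R by rewrite mulr_gt0// pi_gt0.
have ReC y : complex.Re (K (Cexp (ln r +i* y))) =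
    complex.Re (k (Cexp (ln r +i* y))) * (2 + 2 * cos y) - 2 * kap.
  pose z := (cos y +i* sin y).
  have zE : Cexp (ln r +i* y) = r%:C * z.
    rewrite /Cexp/= lnK ?posrE//; apply/eqP; rewrite eq_complex/=.
    by apply/andP; split; apply/eqP; ring.
  have zz : z * z^* = 1.
    apply/eqP; rewrite eq_complex/=; apply/andP; split; apply/eqP; last by ring.
    by rewrite -(cos2Dsin2 y); ring.
  have zn0 : z != 0 by apply/eqP => E0; move: zz; rewrite E0 mul0r => /esym/eqP; rewrite oner_eq0.
  rewrite /K zE.
  have zi : z^-1 = z^* by rewrite -[RHS]mul1r -(mulVf zn0) -mulrA zz mulr1.
  have -> : 2 + r%:C * z / r%:C + r%:C / (r%:C * z) = 2 + z + z^-1.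
    by field; apply/andP; split; [exact: zn0|exact: rC].
  have -> : 2 + z + z^-1 = (2 + 2 * cos y)%:C.
    rewrite zi.
    rewrite rmorphD/= -[2 in LHS]/(2%:R) -(rmorph_nat (real_complex R)) -addrA.
    congr (_ + _); apply/eqP; rewrite eq_complex/=; apply/andP; split; apply/eqP; ring.
  rewrite [_ * (2 + 2 * cos y)%:C]mulrC mulrA -rmorphM ReD !ReZ ReB/= -/kap.
  by rewrite mulfVK ?gt_eqF//; ring.
have : (- 2 * kap) * (2 * pi - 0) <= 2 * pi * complex.Re (r%:C * D).
  rewrite -E -seg_int_cst; last exact: ltW.
  apply: seg_int_le; first exact: seg_cont_cst.
    apply: (@differentiable_seg_cont (fun w => K (Cexp w))) => y.
    apply: differentiable_comp; first exact: differentiable_Cexp.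
    by apply: dK; rewrite normc_Cexp expR_gt0 /= lnK ?posrE.
  move=> y _; rewrite ReC.
  have h1 : 0 <= complex.Re (k (Cexp (ln r +i* y))).
    by apply: k0; rewrite normc_Cexp/= lnK ?posrE.
  have h2 : 0 <= 2 + 2 * cos y by have := cos_geN1 y; lra.
  have := mulr_ge0 h1 h2; lra.
by rewrite ReZ subr0 mulrC ler_pM2l.
Qed.

Lemma is_derive_taylor1 (f : R -> R) (x c : R) :
  (forall e : R, 0 < e -> exists2 d : R, 0 < d &
    forall h : R, `|h| < d -> `|f (x + h) - f x - c * h| <= e * `|h|) ->
  is_derive x 1 f c.
Proof.
move=> H.
have C : h^-1 *: (f (h *: 1 + x) - f x) @[h --> 0^'] --> (c : R^o).
  apply/(@cvgrPdist_le _ R^o) => e e0.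
  have [d d0 Hd] := H _ e0.
  apply/nbhs_ballP; exists d => //= h; rewrite /ball/= sub0r normrN => hd h0.
  have := Hd h hd; rewrite -[h *: 1]/(h * 1) mulr1 [x + h]addrC => le.
  have hn : 0 < `|h| by rewrite normr_gt0.
  rewrite -(ler_pM2r hn) -normrM; apply: le_trans le; rewrite -normrN.
  rewrite le_eqVlt; apply/orP; left; apply/eqP; congr `|_|.
  by rewrite -[h^-1 *: _]/(h^-1 * _); field.
by apply: DeriveDef; [apply/cvg_ex; exists c|exact: cvg_lim C].
Qed.

(** Along the segment the positive harmonic function [u] satisfies
    [u' >= - (2 / r) u], so [u * expR (2 / r * t)] increases. *)
Lemma harnack_segment k (rho r : R) : 0 < r -> r < rho ->
  (forall (t : R) u, 0 <= t <= 1 -> normc u < rho -> differentiable k (t%:C + u)) ->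
  (forall (t : R) u, 0 <= t <= 1 -> normc u < rho -> 0 <= complex.Re (k (t%:C + u))) ->
  complex.Re (k 0) <= expR (2 / r) * complex.Re (k 1).
Proof.
move=> r0 rrho dk k0.
have rho0 : 0 < rho := lt_trans r0 rrho.
pose u (t : R) := complex.Re (k t%:C).
have der (t : R) : 0 <= t <= 1 -> exists2 c, is_derive t 1 u c & - 2 * u t <= r * c.
  move=> t01; have : differentiable k t%:C.
    by have := dk t 0 t01; rewrite normc0 addr0; apply.
  move=> /cdiffP[D kD]; exists (complex.Re D).
    apply: is_derive_taylor1 => e /kD[d d0 Hd]; exists d => // h hd.
    have := Hd h%:C; rewrite normc_real => /(_ hd) le.
    apply: le_trans le; apply: le_trans (Re_norm_le _).
    by rewrite /u rmorphD/= !ReB [D * _]mulrC ReZ mulrC.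
  have := @Re_derivative_ge (fun v => k (t%:C + v)) D rho r r0 rrho.
  rewrite addr0; apply.
  - move=> v vr; apply: (@differentiable_comp _ _ _ _ (fun v => t%:C + v) k); last exact: dk.
    by apply: differentiableD; [exact: differentiable_cst|exact: ex_diff].
  - move=> e /kD[d d0 Hd]; exists d => // h hd; rewrite add0r addr0; exact: Hd.
  - by move=> v vr; exact: k0.
pose v (t : R) := u t * expR (2 / r * t).
have derv (t : R) : 0 <= t <= 1 -> exists2 c, is_derive t 1 v c & 0 <= c.
  move=> /der[c dc hc].
  have dE : is_derive t 1 (fun x : R => expR (2 / r * x)) (2 / r * expR (2 / r * t)).
    have dl : is_derive t 1 (fun x : R => 2 / r * x) (2 / r).
      apply: is_derive_taylor1 => e e0; exists 1 => // h _.
      have -> : 2 / r * (t + h) - 2 / r * t - 2 / r * h = 0 by ring.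
      by rewrite normr0 mulr_ge0// ltW.
    have h := @is_derive1_comp R expR (fun x : R => 2 / r * x) t _ _
      (is_derive_expR (2 / r * t)) dl.
    by apply: (is_derive_eq h); rewrite mulrC.
  exists (u t * (2 / r * expR (2 / r * t)) + expR (2 / r * t) * c).
    exact: is_deriveM.
  have -> : u t * (2 / r * expR (2 / r * t)) + expR (2 / r * t) * c =
    expR (2 / r * t) / r * (r * c - (- 2 * u t)) by field; rewrite gt_eqF.
  by rewrite mulr_ge0 ?subr_ge0// divr_ge0 ?expR_ge0// ltW.
have H : v 0 <= v 1.
  apply: (@ger0_derive1_le_cc R v 0 1).
  - move=> t; rewrite in_itv/= => /andP[t0 t1]; have [|c [dc _] _] := derv t => //.
    by rewrite !ltW.
  - move=> t; rewrite in_itv/= => /andP[t0 t1]; have [|c [_ cE] c0] := derv t.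
      by rewrite !ltW.
    by rewrite derive1E cE.
  - apply: continuous_in_subspaceT => t; rewrite inE/= in_itv/= => /derv[c [dc _] _].
    exact/differentiable_continuous/derivable1_diffP.
  - by rewrite in_itv/= lexx ler01.
  - by rewrite in_itv/= lexx ler01.
  - exact: ler01.
by move: H; rewrite /v mulr0 expR0 !mulr1 /u mulrC.
Qed.

End Harnack.

(** * Bounded holomorphic functions on the polydisc *)

Section PolydiscFacts.
Context {R : realType} {n : nat}.
Local Notation Cn := 'rV[R[i]]_n.

Lemma near_eq_differentiable (f g : Cn -> R[i]) (z : Cn) :
  (\forall w \near z, f w = g w) -> differentiable f z -> differentiable g z.
Proof.
move=> fg df; have fgz : f z = g z := nbhs_singleton fg.
have [cd fE] := (diff_locallyP z f).1 df.
have E : g \o shift z = cst (g z) + ('d f z) +o_ (0 : Cn) id.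
  apply/eqaddoP => eps eps0.
  have fo : \forall h \near (0 : Cn), `|(f \o shift z - (cst (f z) + 'd f z)) h| <= eps * `|h|.
    by have := (eqaddoP _ _ _ _).1 fE eps eps0.
  have fg' : \forall h \near (0 : Cn), f (h + z) = g (h + z).
    by move: fg; rewrite (near_shift 0) subr0.
  apply: filterS2 fo fg' => h; rewrite /= => + fgh.
  by rewrite !fctE /= /shift/= fgh fgz.
have dg := diff_unique cd E.
apply/(diff_locallyP z g); split; first by rewrite [X in continuous X]dg.
by rewrite [X in cst _ + X]dg.
Qed.

Lemma polydisc_max (z : Cn) : polydisc R n z ->
  exists2 m : R, m < 1 & forall i, normc (z ord0 i) <= m.
Proof.
move=> Dz; exists (\big[Num.max/0]_i normc (z ord0 i)).
  by apply: bigmax_lt.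
by move=> i; exact: le_bigmax.
Qed.

Lemma near_polydisc (z : Cn) : polydisc R n z -> \forall w \near z, polydisc R n w.
Proof.
move=> /polydisc_max[m m1 hm].
have d0 : 0 < (1 - m)%:C :> R[i] by rewrite ltcR subr_gt0.
apply/nbhs_ballP; exists (1 - m)%:C => // w [_ H] i.
have := H ord0 i; rewrite /ball/= normc_lt_cplx => h.
have := hm i.
have -> : w ord0 i = z ord0 i - (z ord0 i - w ord0 i) by ring.
rewrite -normcN in h => h1; apply: (le_lt_trans (le_normcD _ _)); lra.
Qed.

(** A bounded holomorphic function on the polydisc, whatever its values
    elsewhere, has a representative in [Hinfty]. *)
Lemma exists_Hinfty (f : Cn -> R[i]) : holomorphic f ->
  bounded_on (polydisc R n) f ->
  exists F : Hinfty R n, forall z, polydisc R n z -> F z = f z.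
Proof.
move=> hf bf.
pose g z := if `[< polydisc R n z >] then f z else 0.
have gE z : polydisc R n z -> g z = f z by move=> Dz; rewrite /g asboolT.
have gP : g \in @bounded_holomorphic R n.
  apply/asboolP; split.
  - move=> z Dz; apply: (@near_eq_differentiable f g); last exact: hf.
    by have := near_polydisc Dz; apply: filterS => w Dw; rewrite gE.
  - by move=> z nDz; rewrite /g asboolF.
  - by have [M hM] := bf; exists M => z Dz; rewrite gE// hM.
by exists (HinftyOf gP) => z; exact: gE.
Qed.

Implicit Types (f g w e : Hinfty R n).

Lemma Hinfty_holomorphic f : holomorphic f.
Proof. by case: f => f /= /asboolP[]. Qed.

Lemma HinftyE f g a z : Hinfty_fun (a *: f + g) z = a * f z + g z.
Proof. by []. Qed.

Lemma le_rnorm f z : polydisc R n z -> normc (f z) <= rnorm f.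
Proof. by move=> Dz; apply: le_supnorm => //; exact: Hinfty_bounded. Qed.

Lemma rnorm_le f (M : R) :
  (forall z, polydisc R n z -> normc (f z) <= M) -> rnorm f <= M.
Proof. by move=> h; apply: supnorm_le => //; exact: polydisc_neq0. Qed.

Lemma exists_evaluation z : polydisc R n z ->
  exists phi : dual (Hinfty R n), forall f, phi f = f z.
Proof.
move=> Dz.
have [||phi phiE] := @dual_of_real _ _ (fun f : Hinfty R n => complex.Re (f z)) 1.
- split=> [f g|t f]; first exact: ReD.
  exact: ReZ.
- by move=> f; rewrite mul1r (le_trans (Re_le_normc _))// le_rnorm.
exists phi => f; apply/eqP; rewrite eq_complex phiE eqxx/=.
have : complex.Re ('i * phi f) = complex.Re ('i * f z).
  by have := phiE ('i *: f); rewrite linearZ.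
by case: (phi f) (f z) => [a b] [c d] /= h; apply/eqP; lra.
Qed.

Definition positive_functional (psi : dual (Hinfty R n)) :=
  forall w, (forall z, polydisc R n z -> 0 <= complex.Re (w z)) ->
  0 <= complex.Re (psi w).

(** When the real part of [w] is nonnegative, [|1 - x w| <= 1 + O(x ^+ 2)] for
    small [x > 0]; if that of [psi w] were negative, that of [psi (1 - x w)]
    would exceed the norm of [psi] by a term of order [x]. *)
Lemma normed_at_one_positive (one : Hinfty R n) (psi : dual (Hinfty R n)) :
  (forall z, polydisc R n z -> one z = 1) ->
  complex.Re (psi one) = dualnorm psi -> positive_functional psi.
Proof.
move=> oneE psi1 w w0; rewrite leNgt; apply/negP => neg.
pose M := rnorm w; have M0 : 0 <= M := rnorm_ge0 w.
pose d := dualnorm psi; have d0 : 0 <= d := dualnorm_ge0 psi.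
pose r := complex.Re (psi w).
(* Small enough for [x * (d * M ^+ 2)] to stay below [- r]: the quadratic error
   is then beaten by the linear gain. *)
pose x := - r / (2 * (d * M ^+ 2 + 1)).
have q0 : 0 <= d * M ^+ 2 by rewrite mulr_ge0// sqr_ge0.
have r0 : r < 0 by [].
have x0 : 0 < x by rewrite divr_gt0 ?oppr_gt0// mulr_gt0//; lra.
have nle : rnorm (- x%:C *: w + one) <= 1 + x ^+ 2 * M ^+ 2.
  apply: rnorm_le => z Dz; rewrite HinftyE oneE//.
  have := w0 _ Dz; have := le_rnorm w Dz; have := normc_sqr (w z).
  have := normc_ge0 (w z).
  have B0 : 0 <= x ^+ 2 * M ^+ 2 by rewrite mulr_ge0// sqr_ge0.
  set N := normc (w z) => N0 NE NM Re0.
  have NM2 : N ^+ 2 <= M ^+ 2 by rewrite ler_sqr ?nnegrE.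
  rewrite -ler_sqr ?nnegrE ?normc_ge0 ?addr_ge0// normc_sqr.
  have -> : complex.Re (- x%:C * w z + 1) = 1 - x * complex.Re (w z).
    by case: (w z) => a b /=; ring.
  have -> : complex.Im (- x%:C * w z + 1) = - (x * complex.Im (w z)).
    by case: (w z) => a b /=; ring.
  have h1 : x ^+ 2 * N ^+ 2 <= x ^+ 2 * M ^+ 2 by rewrite ler_wpM2l// sqr_ge0.
  have h2 : 0 <= x * complex.Re (w z) by rewrite mulr_ge0// ltW.
  have h3 : 0 <= (x ^+ 2 * M ^+ 2) ^+ 2 by rewrite sqr_ge0.
  rewrite NE in h1; move: h1 h2 h3 B0; clear; lra.
have := le_trans (Re_le_normc _) (le_dualnorm psi (- x%:C *: w + one)).
rewrite linearD linearZ/= ReD psi1 -/d.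
have -> : complex.Re (- x%:C *: psi w) = - x * r.
  by rewrite /r; case: (psi w) => a b /=; ring.
have := ler_wpM2l d0 nle => h1 h2.
have h3 := le_trans h2 h1.
have h4 : - r <= x * (d * M ^+ 2).
  by rewrite -(ler_pM2l x0); lra.
have : x * (d * M ^+ 2) < - r.
  rewrite /x -mulrA gtr_pMr ?oppr_gt0// mulrC ltr_pdivrMr; lra.
lra.
Qed.

(** The kernel [1 / (1 - c u)] peaks at [u = 1].  A bound that is affine in
    [Re u] is what a positive functional can be applied to. *)
Lemma Re_kernel_ge (c : R) (u : R[i]) : 0 < c -> c < 1 -> normc u <= 1 ->
  (1 - c)^-1 - 2 / (1 - c) ^+ 3 * (1 - complex.Re u) <= complex.Re (1 - c%:C * u)^-1.
Proof.
move=> c0 c1 u1.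
have u2 : normc u ^+ 2 <= 1 by rewrite expr_le1// normc_ge0.
have xu := Re_le_normc u.
move: u2; rewrite normc_sqr; set x := complex.Re u; set y := complex.Im u => u2.
have x1 : x <= 1 by exact: le_trans xu u1.
have xm1 : -1 <= x by have := Re_norm_le u; rewrite ler_norml => /andP[]; lra.
pose N := 1 - 2 * c * x + c ^+ 2 * (x ^+ 2 + y ^+ 2).
have -> : complex.Re (1 - c%:C * u)^-1 = (1 - c * x) / N.
  rewrite /N /x /y; case: (u) => a b /=.
  by congr (_ / _); ring.
have cx : 0 < 1 - c * x by nra.
have N0 : 0 < N.
  have : 0 < (1 - c * x) ^+ 2 by rewrite exprn_gt0.
  have : 0 <= (c * y) ^+ 2 by rewrite sqr_ge0.
  rewrite /N; lra.
pose N' := 1 - 2 * c * x + c ^+ 2.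
have NN' : N <= N'.
  by have := ler_wpM2l (sqr_ge0 c) u2; rewrite /N /N' mulr1; lra.
have N'0 : 0 < N' := lt_le_trans N0 NN'.
have c2 : (1 - c) ^+ 2 <= N' by rewrite /N'; nra.
have d0 : 0 < 1 - c by rewrite subr_gt0.
apply: (@le_trans _ _ ((1 - c * x) / N')); last first.
  by rewrite ler_pM2l// lef_pV2 ?posrE.
have -> : (1 - c * x) / N' = (1 - c)^-1 - c * (1 + c) * (1 - x) / (N' * (1 - c)).
  by rewrite /N'; field; rewrite -/N' !gt_eqF.
rewrite lerD2l lerN2 ler_pdivrMr; last by rewrite mulr_gt0.
have -> : 2 / (1 - c) ^+ 3 * (1 - x) * (N' * (1 - c)) =
    2 * (N' / (1 - c) ^+ 2) * (1 - x) by field; rewrite gt_eqF.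
have h1 : c * (1 + c) <= 2 by nra.
have h2 : 1 <= N' / (1 - c) ^+ 2 by rewrite ler_pdivlMr ?exprn_gt0// mul1r.
by apply: ler_wpM2r; lra.
Qed.

End PolydiscFacts.

(** * Functions close to 1 in the unit ball of an M-ideal *)

Section ApproximateUnit.
Context {R : realType} {n : nat}.
Local Notation Cn := 'rV[R[i]]_n.
Local Notation X := (Hinfty R n).
Variables (J : set X) (P : {linear dual X -> dual X}).
Hypotheses (Jsub : is_subspace J) (PL : is_L_projection P)
  (PJ : range P = annihilator J).
Implicit Types (f g w e : X).

Lemma dual_combination (psi : dual X) (u v w : X) (k l : R[i]) :
  psi (w + k *: (u - v) - l *: u) = psi w + k * (psi u - psi v) - l * psi u.
Proof. by rewrite linearB linearD !linearZ linearB. Qed.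

Lemma exists_one : exists one : X, forall z, polydisc R n z -> one z = 1.
Proof.
apply: (@exists_Hinfty _ _ (fun=> 1)) => [z _|]; first exact: differentiable_cst.
by exists 1 => z _; rewrite normc_real normr1.
Qed.

Lemma exists_kernel (c : R) e : 0 < c -> c < 1 -> rnorm e <= 1 ->
  exists w : X, forall z, polydisc R n z -> w z = (1 - c%:C * e z)^-1.
Proof.
move=> c0 c1 e1.
have ce z : polydisc R n z -> 1 - c <= normc (1 - c%:C * e z).
  move=> Dz; apply: le_trans (le_normcB _ _); rewrite normc_real normr1 lerD2l lerN2.
  have ez : normc (e z) <= 1 := le_trans (le_rnorm e Dz) e1.
  by rewrite normcM normc_real gtr0_norm// ler_piMr// ltW.
have d0 : 0 < 1 - c by rewrite subr_gt0.
have nz z : polydisc R n z -> 1 - c%:C * e z != 0.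
  by move=> /ce h; apply/eqP => E; move: h; rewrite E normc0; lra.
apply: (@exists_Hinfty _ _ (fun z => (1 - c%:C * e z)^-1)) => [z Dz|].
  apply: (@differentiableV _ _ (fun z => 1 - c%:C * e z)); last exact: nz.
  apply: differentiableB; first exact: differentiable_cst.
  apply: (@differentiableM _ _ (fun=> c%:C) e); first exact: differentiable_cst.
  exact: Hinfty_holomorphic.
exists (1 - c)^-1 => z Dz; rewrite normcV lef_pV2 ?posrE ?ce//.
exact: lt_le_trans d0 (ce _ Dz).
Qed.

(** Split the evaluation [phi] at [z] into [a := P phi], which kills [J], and
    [b := phi - P phi], which is normed by [J].  Both are positive and their
    norms [t] and [s] add up to 1.  If [e] in the unit ball of [J] almost norms
    [b] then [e z = b e] is close to [s], while the kernel
    [w := 1 / (1 - c e)] has [b w] close to [s / (1 - c)]; as [a] is positive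
    this forces [s / (1 - c) <= Re (w z) <= 1 / t] for every [c < 1], so that
    [t = 0] or [s = 0].  The latter would mean that all of [J] vanishes at
    [z]. *)
Lemma near_one_at_point f z (eta : R) : J f -> polydisc R n z -> f z != 0 ->
  0 < eta -> exists e, [/\ J e, rnorm e <= 1 & 1 - eta < complex.Re (e z)].
Proof.
move=> Jf Dz fz eta0.
have [one oneE] := exists_one.
have [phi phiE] := exists_evaluation Dz.
pose a := P phi; have [b bE] : exists b, b = phi - P phi by exists (phi - P phi).
pose t := dualnorm a; pose s := dualnorm b.
have t0 : 0 <= t := dualnorm_ge0 a.
have s0 : 0 <= s := dualnorm_ge0 b.
have one1 : rnorm one <= 1.
  by apply: rnorm_le => z' Dz'; rewrite oneE// normc_real normr1.
have phi1 : dualnorm phi <= 1.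
  apply: dualnorm_le => x x1; rewrite phiE (le_trans (Re_le_normc _))//.
  exact: le_trans (le_rnorm x Dz) x1.
have ts : t + s <= 1 by rewrite /t /s bE (Lproj_norm PL).
have abE (x : X) : x z = a x + b x by rewrite bE dualB -phiE addrC subrK.
have ea e : J e -> a e = 0 by move=> Je; exact: (Lproj_ann PJ phi Je).
have ebE e : J e -> b e = e z by move=> Je; rewrite abE ea// add0r.
have R1 : complex.Re (a one) + complex.Re (b one) = 1.
  by rewrite -ReD -abE oneE.
have Ra := Re_dual_le a one1; have Rb := Re_dual_le b one1.
have a1 : complex.Re (a one) = t by rewrite -/t -/s in Ra Rb; lra.
have b1 : complex.Re (b one) = s by rewrite -/t -/s in Ra Rb; lra.
have pa : positive_functional a := normed_at_one_positive oneE a1.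
have pb : positive_functional b := normed_at_one_positive oneE b1.
have Pb : P b = 0.
  by rewrite bE linearB/=; have [_ -> _] := PL; rewrite subrr.
have bnear (d : R) : 0 < d -> exists e, [/\ J e, rnorm e <= 1 & s - d < complex.Re (e z)].
  move=> d0; apply: contrapT => /forallNP H.
  have : s <= s - d; last lra.
  apply: (dualnorm_ker_Lproj Jsub PL PJ Pb) => y Jy y1; rewrite leNgt; apply/negP => h.
  by apply: (H y); split => //; rewrite -ebE.
suff t_eq0 : t = 0.
  have [e [Je e1 es]] := bnear eta eta0; exists e; split => //.
  by apply: le_lt_trans es; rewrite lerD2r; lra.
apply/eqP/negPn/negP => tn0.
have tp : 0 < t by rewrite lt_neqAle eq_sym tn0.
have sp : 0 < s.
  rewrite lt_neqAle s0 andbT eq_sym; apply/negP => /eqP sE.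
  move/eqP: fz; apply; rewrite abE ea// add0r; apply: eq0_normc; apply/eqP.
  by rewrite eq_le normc_ge0 andbT; have := le_dualnorm b f; rewrite -/s sE mul0r.
have ts1 : t + s = 1 by lra.
(* Chosen to make [s / (1 - c)] exceed [t^-1] by 1. *)
pose c := 1 - s / (t^-1 + 1).
have ti : 0 < t^-1 by rewrite invr_gt0.
have t1 : t < 1 by lra.
have cE : s / (1 - c) = t^-1 + 1.
  have -> : 1 - c = s / (t^-1 + 1) by rewrite /c; ring.
  by rewrite invfM invrK mulrA divff ?gt_eqF// mul1r.
have q0 : 0 < s / (t^-1 + 1) by rewrite divr_gt0//; lra.
have q1 : s / (t^-1 + 1) < 1 by rewrite ltr_pdivrMr; lra.
have c0 : 0 < c by rewrite /c; lra.
have c1 : c < 1 by rewrite /c; lra.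
pose K := 2 / (1 - c) ^+ 3.
have K0 : 0 < K by rewrite divr_gt0// exprn_gt0//; lra.
have [|e [Je e1 es]] := bnear (1 / (2 * K)); first by rewrite divr_gt0// mulr_gt0.
have [w wE] := exists_kernel c0 c1 e1.
have eD z' : polydisc R n z' -> normc (e z') <= 1.
  by move=> Dz'; exact: le_trans (le_rnorm e Dz') e1.
have w0 z' : polydisc R n z' ->
    (1 - c)^-1 - K * (1 - complex.Re (e z')) <= complex.Re (w z').
  by move=> Dz'; rewrite wE//; apply: Re_kernel_ge => //; exact: eD.
have wpos z' : polydisc R n z' -> 0 <= complex.Re (w z').
  move=> Dz'; rewrite wE//; have := eD _ Dz' => e1'.
  have le1 : c * complex.Re (e z') <= 1.
    have := le_trans (Re_le_normc _) e1'; nra.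
  move: le1; case: (e z') => x y /= le1.
  apply: divr_ge0; first by lra.
  by rewrite addr_ge0// sqr_ge0.
have bw : s / (1 - c) - K * (s - complex.Re (e z)) <= complex.Re (b w).
  have := pb (w + K%:C *: (one - e) - (1 - c)^-1%:C *: one).
  have -> : b (w + K%:C *: (one - e) - (1 - c)^-1%:C *: one) =
      b w + K%:C * (b one - b e) - (1 - c)^-1%:C * b one.
    exact: dual_combination.
  rewrite ReB ReD !ReZ ReB b1 (ebE _ Je).
  move=> H; suff : 0 <= complex.Re (b w) + K * (s - complex.Re (e z)) - (1 - c)^-1 * s.
    by move: ((1 - c)^-1) => iv; lra.
  apply: H => z' Dz'.
  have -> : Hinfty_fun (w + K%:C *: (one - e) - (1 - c)^-1%:C *: one) z' =
     w z' + K%:C * (one z' - e z') - (1 - c)^-1%:C * one z' by [].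
  have := w0 _ Dz'; rewrite ReB ReD !ReZ oneE// ReB/=; lra.
have aw := pa _ wpos.
have wz : complex.Re (w z) <= t^-1.
  apply: (le_trans (Re_le_normc _)); rewrite wE// normcV lef_pV2 ?posrE//.
    apply: (@le_trans _ _ (1 - c * s)); first nra.
    apply: le_trans (le_normcB _ _); rewrite normc_real normr1 lerD2l lerN2.
    rewrite normcM normc_real gtr0_norm// ler_pM2l//.
    have := le_dualnorm b e; rewrite ebE// => /le_trans; apply.
    by rewrite ler_piMr.
  rewrite lt_neqAle normc_ge0 andbT eq_sym; apply/eqP => /eq0_normc E.
  have : complex.Re (1 - c%:C * e z) = 0 by rewrite E.
  have := le_trans (Re_le_normc (e z)) (eD _ Dz).
  by rewrite ReB ReZ/=; nra.
have := abE w; move=> /(congr1 (@complex.Re R)); rewrite ReD => wab.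
have KK : K * (s - complex.Re (e z)) <= 1 / 2.
  have : K * (s - complex.Re (e z)) <= K * (1 / (2 * K)) by rewrite ler_pM2l//; lra.
  by have -> : K * (1 / (2 * K)) = 1 / 2 by field; rewrite gt_eqF.
lra.
Qed.

(** Harnack's inequality for [1 - e] carries the estimate from a point
    [z] where [f] does not vanish to the origin. *)
Lemma near_one_at_zero f (eta : R) : J f -> f <> 0 -> 0 < eta ->
  exists e, [/\ J e, rnorm e <= 1 & 1 - eta < complex.Re (e 0)].
Proof.
move=> Jf f0 eta0.
have [z [Dz fz]] : exists z, polydisc R n z /\ f z != 0.
  apply: contrapT => /forallNP H; apply: f0; apply/val_inj/funext => z /=.
  have [Dz|nDz] := pselect (polydisc R n z).
    by apply/eqP/negPn/negP => fz; apply: (H z).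
  by case: (f) => g /= /asboolP[_ g0 _]; exact: g0.
have [m m1 hm] := polydisc_max Dz.
(* The discs of radius [rho] about the points of [0, 1] are mapped into the
   polydisc by [u |-> u *: z]. *)
pose rho := (1 - m) / 2.
have rho0 : 0 < rho by rewrite divr_gt0// subr_gt0.
have [r [r0 rrho]] : exists r, 0 < r /\ r < rho by exists (rho / 2); split; lra.
pose C := expR (2 / r).
have [|e [Je e1 ez]] := near_one_at_point Jf Dz fz (_ : 0 < eta / C).
  by rewrite divr_gt0// expR_gt0.
exists e; split => //.
have Dseg (s : R) u : 0 <= s <= 1 -> normc u < rho ->
    polydisc R n ((s%:C + u) *: z).
  move=> /andP[s0 s1] ur i; rewrite mxE normcM.
  have h1 : normc (s%:C + u) <= 1 + rho.
    by apply: normc_le2; [rewrite normc_real ger0_norm|exact: ltW].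
  have zi : normc (z ord0 i) < 1 by exact: Dz.
  have := hm i; have := normc_ge0 (z ord0 i) => z0 zm.
  have m0 : 0 <= m := le_trans z0 zm.
  have : normc (s%:C + u) * normc (z ord0 i) <= (1 + rho) * m.
    by rewrite ler_pM// normc_ge0.
  move=> /le_lt_trans; apply; rewrite /rho; nra.
have eD z' : polydisc R n z' -> complex.Re (e z') <= 1.
  by move=> Dz'; rewrite (le_trans (Re_le_normc _))// (le_trans (le_rnorm e Dz')).
have h : complex.Re (1 - e (0 *: z)) <= C * complex.Re (1 - e (1 *: z)).
  apply: (@harnack_segment R (fun u => 1 - e (u *: z)) rho r r0 rrho).
  - move=> s u s01 ur; apply: differentiableB; first exact: differentiable_cst.
    apply: (@differentiable_comp _ _ _ _ (fun u : R[i] => u *: z) e) => //.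
    by apply: Hinfty_holomorphic; exact: Dseg.
  - by move=> s u s01 ur; rewrite ReB subr_ge0; apply: eD; exact: Dseg.
rewrite scale0r scale1r !ReB/= in h.
have C0 : 0 < C by rewrite expR_gt0.
have : C * (1 - complex.Re (e z)) < C * (eta / C) by rewrite ltr_pM2l//; lra.
have -> : C * (eta / C) = eta by field; rewrite gt_eqF.
lra.
Qed.

End ApproximateUnit.

(** * Rotation invariance of the torus measure *)

Section PeriodicShift.
Context {R : realType}.
Local Notation mu := (@lebesgue_measure R).
Local Notation angle := (measurableTypeR R).
Implicit Types (h : angle -> R).

Lemma measurable_translation (c : R) : measurable_fun setT (fun x : angle => c + x : angle).
Proof.
apply: continuous_measurable_fun => x.
by apply: (@continuousD _ R^o R^o (fun=> c) id); [exact: cst_continuous|exact: cvg_id].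
Qed.

Lemma lebesgue_measure_shift (c : R) (A : set R) : measurable A ->
  pushforward mu (fun x : angle => c + x : angle) A = mu A.
Proof.
move=> mA; apply/esym.
have mc := measurable_translation c.
pose mc_mixin := isMeasurableFun.Build _ _ _ _ _ mc.
pose mcp : {mfun angle >-> angle} := HB.pack (fun x : angle => c + x : angle) mc_mixin.
apply: (@lebesgue_measure_unique _ (pushforward mu mcp)) => //= _ [[a b]] _ <-.
rewrite /pushforward/=.
have -> : (fun x : R => c + x) @^-1` `]a, b] = `]a - c, b - c]%classic.
  by apply/seteqP; split=> x /=; rewrite !in_itv/= => /andP[? ?]; lra.
by rewrite !lebesgue_measure_itv/= !lte_fin ltrD2r -!EFinB; congr (if _ then _ else _); congr EFin; ring.
Qed.

Lemma integral_shift h (a b c : R) : measurable_fun setT h -> (forall x, 0 <= h x) ->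
  (\int[mu]_(x in `[a, b[) (h (c + x))%:E = \int[mu]_(x in `[(c + a)%R, (c + b)%R[) (h x)%:E)%E.
Proof.
move=> mh h0; have mc := measurable_translation c.
have -> : `[a, b[%classic = (fun x : angle => c + x : angle) @^-1` `[c + a, c + b[.
  by apply/seteqP; split=> x /=; rewrite !in_itv/= => /andP[? ?]; lra.
rewrite -(ge0_integral_pushforward mc mu (f := EFin \o h))//=; last 2 first.
- by apply/measurable_EFinP; exact: measurable_funS mh.
- by move=> x _; rewrite lee_fin.
by apply: eq_measure_integral => //= A mA AS; exact: lebesgue_measure_shift.
Qed.

(** The part of the shifted interval that leaves [0, 2 pi] on the right comes
    back on the left. *)
Lemma integral_periodic_shift h (c : R) : measurable_fun setT h ->
  (forall x, 0 <= h x) -> (forall x, h (2 * pi + x) = h x) -> 0 <= c <= 2 * pi ->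
  (\int[uniform_prob (@two_pi_gt0 R)]_x (h (c + x)%R)%:E =
   \int[uniform_prob (@two_pi_gt0 R)]_x (h x)%:E)%E.
Proof.
move=> mh h0 hp /andP[c0 c2].
have mhc : measurable_fun setT (fun x : angle => h (c + x)).
  exact: measurableT_comp mh (measurable_translation c).
rewrite !integral_uniform//; last 3 first.
- exact/measurable_EFinP.
- exact/measurable_EFinP.
- by move=> x; rewrite lee_fin.
congr (_ * _)%E.
have mhE D : measurable_fun D (EFin \o h).
  by apply/measurable_EFinP; exact: measurable_funS mh.
have mhcE D : measurable_fun D (EFin \o (fun x : angle => h (c + x))).
  by apply/measurable_EFinP; exact: measurable_funS mhc.
rewrite -integral_itv_bndo_bndc//; last exact: mhcE.
rewrite -integral_itv_bndo_bndc//; last exact: mhE.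
rewrite integral_shift// addr0.
have U (x y z : R) : x <= y -> y <= z ->
    (\int[mu]_(t in `[x, z[) (h t)%:E =
     \int[mu]_(t in `[x, y[) (h t)%:E + \int[mu]_(t in `[y, z[) (h t)%:E)%E.
  move=> xy yz; rewrite (@itv_bndbnd_setU _ _ _ (BLeft y)) ?bnd_simp//.
  rewrite ge0_integral_setU//=.
  - by move=> t _; rewrite lee_fin.
  - apply/disj_setPS => t [/=]; rewrite 2!in_itv/= => /andP[_ yx] /andP[xy' _].
    by rewrite leNgt yx in xy'.
rewrite (U c (2 * pi) _)//; last by rewrite lerDr.
rewrite [in RHS](U 0 c _)// addeC; congr (_ + _)%E.
have -> : (c + 2 * pi)%R = 2 * pi + c by rewrite addrC.
have {1}-> : 2 * pi = 2 * pi + 0 :> R by rewrite addr0.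
by rewrite -integral_shift//; apply: eq_integral => x _; rewrite hp.
Qed.

End PeriodicShift.

Section TorusRotation.
Context {R : realType}.
Local Notation angle := (measurableTypeR R).

(** On the points of the torus this is multiplication by a scalar of modulus
    1. *)
Definition torus_rot n (c : R) (t : n.-tuple angle) : n.-tuple angle :=
  [the n.-tuple angle of map (fun x : R => c + x) t].

Lemma tnth_torus_rot n c (t : n.-tuple angle) i :
  tnth (torus_rot c t) i = c + tnth t i.
Proof. by rewrite tnth_map. Qed.

Lemma torus_rot_cons n c (x : angle) (t : n.-tuple angle) :
  torus_rot c (tuple_cons (x, t)) = tuple_cons (c + x, torus_rot c t).
Proof. exact/val_inj. Qed.

Lemma measurable_torus_rot n :
  measurable_fun setT (fun p : angle * n.-tuple angle => torus_rot p.1 p.2).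
Proof.
apply/measurable_fun_tnthP => i.
rewrite (_ : _ \o _ = (fun p : angle * n.-tuple angle => p.1 + tnth p.2 i)).
  apply: measurable_funD; first exact: measurable_fst.
  by apply: (@measurableT_comp _ _ _ _ _ _ (fun t : n.-tuple angle => tnth t i));
    [exact: measurable_tnth|exact: measurable_snd].
by apply/funext => p /=; rewrite tnth_torus_rot.
Qed.

(** Some coordinates may be shifted and others not, so that freezing coordinates
    preserves periodicity. *)
Definition torus_periodic n (H : n.-tuple angle -> R) :=
  forall t t', (forall i, tnth t' i = tnth t i \/ tnth t' i = 2 * pi + tnth t i) ->
  H t' = H t.

Lemma measurable_cons_slice n (y : angle) :
  measurable_fun setT (fun t : n.-tuple angle => tuple_cons (y, t)).
Proof.
by apply: (measurable_cons (f := cst y) (g := id)).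
Qed.

Lemma measurable_cons_slice1 n (t : n.-tuple angle) :
  measurable_fun setT (fun y : angle => tuple_cons (y, t)).
Proof.
by apply: (measurable_cons (f := id) (g := cst t)).
Qed.

(** Rotate one coordinate at a time, exchanging the order of integration. *)
Lemma integral_torus_rot n (H : n.-tuple angle -> R) (c : R) :
  measurable_fun setT H -> (forall t, 0 <= H t) -> torus_periodic H ->
  0 <= c <= 2 * pi ->
  (\int[torus_measure n]_t (H (torus_rot c t))%:E =
   \int[torus_measure n]_t (H t)%:E)%E.
Proof.
move=> + + + c02; elim: n H => [|n IH] H mH H0 pH.
  apply: eq_integral => t _; congr EFin; congr H.
  by apply: eq_from_tnth => -[].
have mrot : measurable_fun setT (torus_rot c : n.+1.-tuple angle -> n.+1.-tuple angle).
  apply: (@measurableT_comp _ _ _ _ _ _ (fun p : angle * n.+1.-tuple angle => torus_rot p.1 p.2) _ (fun t => (c, t))).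
    exact: measurable_torus_rot.
  by apply: measurable_fun_pair => //; exact: measurable_cst.
have tonelli (F : n.+1.-tuple angle -> R) : measurable_fun setT F ->
    (forall t, 0 <= F t) ->
    (\int[torus_measure n.+1]_t (F t)%:E =
     \int[uniform_prob (@two_pi_gt0 R)]_x \int[torus_measure n]_t (F (tuple_cons (x, t)))%:E)%E /\
    (\int[torus_measure n.+1]_t (F t)%:E =
     \int[torus_measure n]_t \int[uniform_prob (@two_pi_gt0 R)]_x (F (tuple_cons (x, t)))%:E)%E.
  move=> mF F0.
  have mFc : measurable_fun setT (EFin \o F \o @tuple_cons R n).
    apply: (@measurableT_comp _ _ _ _ _ _ (EFin \o F)); first exact/measurable_EFinP.
    exact: measurable_tuple_cons.
  have Fc0 p : (0 <= (EFin \o F \o @tuple_cons R n) p)%E by rewrite lee_fin.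
  have E : (\int[torus_measure n.+1]_t (F t)%:E =
      \int[uniform_prob (@two_pi_gt0 R) \x torus_measure n]_p (F (tuple_cons p))%:E)%E.
    rewrite /= ge0_integral_distribution//; exact/measurable_EFinP.
  by split; rewrite E; [exact: fubini_tonelli1|exact: fubini_tonelli2].
have mHr : measurable_fun setT (H \o torus_rot c) by exact: measurableT_comp mrot.
rewrite (tonelli _ mHr (fun t => H0 _)).1.
rewrite (tonelli H mH H0).2.
transitivity (\int[uniform_prob (@two_pi_gt0 R)]_x \int[torus_measure n]_t
    (H (tuple_cons ((c + x)%R, t)))%:E)%E.
  apply: eq_integral => x _.
  rewrite -(IH (fun t => H (tuple_cons (c + x, t))))//.
  - by apply: eq_integral => t _; rewrite -torus_rot_cons.
  - by apply: measurableT_comp mH _; exact: measurable_cons_slice.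
  - move=> t t' tt'; apply: pH => i; case: (unliftP ord0 i) => [j|] ->.
      by rewrite !tnthS.
    by left; rewrite !tnth0.
pose F (p : angle * n.-tuple angle) : \bar R := (H (tuple_cons ((c + p.1)%R, p.2)))%:E.
have mF : measurable_fun setT F.
  apply/measurable_EFinP; apply: measurableT_comp mH _.
  apply: (@measurable_cons _ _ _ _ (fun p : angle * n.-tuple angle => c + p.1) _ snd).
    by apply: measurable_funD; [exact: measurable_cst|exact: measurable_fst].
  exact: measurable_snd.
have F0 p : (0 <= F p)%E by rewrite lee_fin.
transitivity (\int[torus_measure n]_t \int[uniform_prob (@two_pi_gt0 R)]_x F (x, t))%E.
  exact: (fubini_tonelli F mF F0).
apply: eq_integral => t _.
apply: (integral_periodic_shift (h := fun x => H (tuple_cons (x, t)))) => //.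
- by apply: measurableT_comp mH _; exact: measurable_cons_slice1.
- move=> x; apply: pH => i; case: (unliftP ord0 i) => [j|] ->.
    by left; rewrite !tnthS.
  by right; rewrite !tnth0.
Qed.

(** The integral of a rotated function does not depend on the angle; average
    over the angle and exchange the integrals. *)
Lemma torus_average n (H : n.-tuple angle -> R) :
  measurable_fun setT H -> (forall t, 0 <= H t) -> torus_periodic H ->
  (\int[torus_measure n]_t (H t)%:E =
   \int[torus_measure n]_t \int[uniform_prob (@two_pi_gt0 R)]_c
      (H (torus_rot c t))%:E)%E.
Proof.
move=> mH H0 pH.
have mHr : measurable_fun setT
    (fun p : angle * n.-tuple angle => (H (torus_rot p.1 p.2))%:E).
  by apply/measurable_EFinP; apply: measurableT_comp mH _; exact: measurable_torus_rot.
pose F (p : angle * n.-tuple angle) : \bar R := (H (torus_rot p.1 p.2))%:E.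
have F0 p : (0 <= F p)%E by rewrite lee_fin.
transitivity (\int[uniform_prob (@two_pi_gt0 R)]_x \int[torus_measure n]_t F (x, t))%E;
  last exact: (fubini_tonelli F mHr F0).
have mF := @measurable_fun_fubini_tonelli_F _ _ _ _ R (torus_measure n) F mHr F0.
rewrite integral_uniform//; last first.
  by move=> c; apply: integral_ge0 => t _; rewrite lee_fin.
have -> : (\int[lebesgue_measure]_(x in `[0%R, (2 * pi)%R]) fubini_F (torus_measure n) F x =
    \int[lebesgue_measure]_(x in `[0%R, (2 * pi)%R]) \int[torus_measure n]_t (H t)%:E)%E.
  apply: eq_integral => c; rewrite inE/= in_itv/= => c02.
  exact: integral_torus_rot.
rewrite integral_cst//= lebesgue_measure_itv/= lte_fin two_pi_gt0.
rewrite -EFinB !subr0 muleCA -EFinM mulVf ?mule1//.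
by rewrite gt_eqF// two_pi_gt0.
Qed.

End TorusRotation.

(** * Measurability on the torus *)

Section TupleMeasurability.
Context {R : realType}.
Local Notation angle := (measurableTypeR R).

Definition tuple_continuous n (H : n.-tuple angle -> R) :=
  forall t (e : R), 0 < e -> exists2 d : R, 0 < d &
  forall t', (forall i, `|tnth t' i - tnth t i| < d) -> `|H t' - H t| <= e.

Definition tuple_floor n (m : nat) (t : n.-tuple angle) : n.-tuple int :=
  [tuple Num.floor (m.+1%:R * tnth t i) | i < n].

Definition tuple_grid n (m : nat) (z : n.-tuple int) : n.-tuple angle :=
  [tuple ((tnth z i)%:~R / m.+1%:R : R) | i < n].

Lemma measurable_tuple_floor n m (z : n.-tuple int) :
  measurable [set t : n.-tuple angle | tuple_floor m t = z].
Proof.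
pose F (i : 'I_n) := (fun t : n.-tuple angle => tnth t i) @^-1`
  `[(tnth z i)%:~R / m.+1%:R, (tnth z i + 1)%:~R / m.+1%:R[%classic.
have -> : [set t : n.-tuple angle | tuple_floor m t = z] = \bigcap_(i in [set: 'I_n]) F i.
  have m0 : 0 < m.+1%:R :> R by rewrite ltr0n.
  apply/seteqP; split=> t /=.
    move=> tz i _; rewrite /F/= in_itv/= -tz tnth_mktuple.
    rewrite ler_pdivrMr// ltr_pdivlMr// [tnth t i * _]mulrC.
    by have := floor_itv (m.+1%:R * tnth t i).
  move=> h; apply: eq_from_tnth => i; rewrite tnth_mktuple.
  have := h i Logic.I; rewrite /F/= in_itv/=.
  rewrite ler_pdivrMr// ltr_pdivlMr// [tnth t i * _]mulrC => hz.
  by apply/eqP; rewrite floor_eq.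
apply: fin_bigcap_measurable => // i _.
rewrite -[X in measurable X]setTI; apply: measurable_tnth => //.
Qed.

(** A continuous function is the limit of its values on finer and finer
    grids, and each of these approximations is constant on the cells of a
    countable measurable partition. *)
Lemma tuple_continuous_measurable n (H : n.-tuple angle -> R) :
  tuple_continuous H -> measurable_fun setT H.
Proof.
move=> cH.
pose h (m : nat) (t : n.-tuple angle) := H (tuple_grid m (tuple_floor m t)).
apply: (@measurable_fun_cvg _ _ _ setT h).
  move=> m _ A mA; rewrite setTI.
  have -> : h m @^-1` A = \bigcup_z (if `[< A (H (tuple_grid m z)) >]
      then [set t : n.-tuple angle | tuple_floor m t = z] else set0).
    apply/seteqP; split=> t /=.
      by move=> At; exists (tuple_floor m t) => //; rewrite asboolT.
    by move=> [z _]; case: asboolP => //= Az tz; rewrite /h tz.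
  apply: countable_bigcupT_measurable => [|z]; first exact: countableP.
  by case: ifP => // _; exact: measurable_tuple_floor.
move=> t _; apply/(@cvgrPdist_le _ R^o) => e e0.
have [d d0 Hd] := cH t e e0.
have [k kd] : exists k : nat, d^-1 < k%:R.
  by exists (Num.truncn d^-1).+1; exact: truncnS_gt.
near=> m; rewrite distrC; apply: Hd => i; rewrite tnth_mktuple tnth_mktuple.
have m0 : 0 < m.+1%:R :> R by rewrite ltr0n.
have md : d^-1 < m.+1%:R.
  apply: (lt_trans kd); rewrite ltr_nat ltnS; near: m; exact: nbhs_infty_ge.
have /andP[h1 h2] := floor_itv (m.+1%:R * tnth t i).
set f := (Num.floor _)%:~R in h1 h2 *.
have {}h2 : m.+1%:R * tnth t i < f + 1 by move: h2; rewrite intrD.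
have md' : 1 < d * m.+1%:R by rewrite -ltr_pdivrMl// mulr1.
have -> : f / m.+1%:R - tnth t i = (f - m.+1%:R * tnth t i) / m.+1%:R.
  by field; rewrite gt_eqF.
rewrite normrM normfV (ger0_norm (ltW m0)) ltr_pdivrMr//.
by apply: (@le_lt_trans _ _ 1) => //; rewrite ler_norml; apply/andP; split; lra.
Unshelve. all: by end_near. Qed.

End TupleMeasurability.

Section TorusFunctions.
Context {R : realType} {n : nat}.
Local Notation Cn := 'rV[R[i]]_n.
Local Notation angle := (measurableTypeR R).

Lemma continuous_epsilon (f : Cn -> R[i]) (z : Cn) : {for z, continuous f} ->
  forall e : R, 0 < e -> exists2 d : R, 0 < d &
  forall w : Cn, (forall i, normc (w ord0 i - z ord0 i) < d) -> normc (f w - f z) <= e.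
Proof.
move=> cf e e0.
have eC : 0 < e%:C :> R[i] by rewrite ltcR.
have : \forall w \near z, `|f z - f w| <= e%:C.
  by move: cf => /(@cvgrPdist_le _ R[i]); apply.
move=> /nbhs_ballP[d /= /gt0_cplx[-> d0] Hd].
exists (complex.Re d) => // w hw.
rewrite -lecR -normCE distrC; apply: Hd; split; first by rewrite ltcR.
by move=> i j; rewrite ord1 /ball/= normc_lt_cplx -normcN opprB.
Qed.

Lemma cos_lipschitz (x y : R) : `|cos x - cos y| <= `|x - y|.
Proof.
wlog xy : x y / y <= x.
  move=> h; have [|/ltW yx] := leP y x; first exact: h.
  by rewrite distrC [leRHS]distrC; exact: h.
have [|c _ ->] := @MVT_segment R cos (fun x => - sin x) y x xy.
  by apply: continuous_subspaceT; exact: continuous_cos.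
by rewrite normrM ler_piMl// normrN ler_norml sin_geN1 sin_le1.
Qed.

Lemma sin_lipschitz (x y : R) : `|sin x - sin y| <= `|x - y|.
Proof.
wlog xy : x y / y <= x.
  move=> h; have [|/ltW yx] := leP y x; first exact: h.
  by rewrite distrC [leRHS]distrC; exact: h.
have [|c _ ->] := @MVT_segment R sin cos y x xy.
  by apply: continuous_subspaceT; exact: continuous_sin.
by rewrite normrM ler_piMl// ler_norml cos_geN1 cos_le1.
Qed.

Lemma polydisc_torus (r : R) (t : n.-tuple angle) : 0 <= r < 1 ->
  polydisc R n (r%:C *: torus_point t).
Proof.
move=> /andP[r0 r1] i; rewrite !mxE normcM normc_real ger0_norm//.
by rewrite /= cos2Dsin2 sqrtr1 mulr1.
Qed.

Lemma torus_close (f : Cn -> R[i]) (r : R) : holomorphic f -> 0 <= r < 1 ->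
  forall (t : n.-tuple angle) (e : R), 0 < e -> exists2 d : R, 0 < d &
  forall t' : n.-tuple angle, (forall i, `|tnth t' i - tnth t i| < d) ->
   normc (f (r%:C *: torus_point t') - f (r%:C *: torus_point t)) <= e.
Proof.
move=> hf r01 t e e0; have /andP[r0 r1] := r01.
have /differentiable_continuous cf := hf _ (polydisc_torus t r01).
have [d d0 Hd] := continuous_epsilon cf e0.
exists (d / 2) => [|t' ht]; first by rewrite divr_gt0.
apply: Hd => i; rewrite !mxE -mulrBr normcM normc_real ger0_norm//.
apply: (@le_lt_trans _ _ (2 * `|tnth t' i - tnth t i|)); last by have := ht i; lra.
rewrite -[leRHS]mul1r; apply: ler_pM => //; [exact: normc_ge0|exact: ltW|].
apply: (le_trans (normc_le_ReIm _)) => /=.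
have := cos_lipschitz (tnth t' i) (tnth t i).
have := sin_lipschitz (tnth t' i) (tnth t i); lra.
Qed.

Lemma measurable_Re_torus (f : Cn -> R[i]) (r : R) : holomorphic f -> 0 <= r < 1 ->
  measurable_fun setT (fun t : n.-tuple angle => complex.Re (f (r%:C *: torus_point t))).
Proof.
move=> hf r01; apply: tuple_continuous_measurable => t e e0.
have [d d0 Hd] := torus_close hf r01 t e0; exists d => // t' /Hd.
by apply: le_trans; rewrite -ReB Re_norm_le.
Qed.

Lemma measurable_Im_torus (f : Cn -> R[i]) (r : R) : holomorphic f -> 0 <= r < 1 ->
  measurable_fun setT (fun t : n.-tuple angle => complex.Im (f (r%:C *: torus_point t))).
Proof.
move=> hf r01; apply: tuple_continuous_measurable => t e e0.
have [d d0 Hd] := torus_close hf r01 t e0; exists d => // t' /Hd.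
apply: le_trans; apply: le_trans (Im_norm_le _).
by case: (f _) (f _) => [a b] [c d'].
Qed.

Lemma torus_point_rot (c : R) (t : n.-tuple angle) (r : R) :
  r%:C *: torus_point (torus_rot c t) =
  (r%:C * Cexp (0 +i* c)) *: torus_point t.
Proof.
rewrite -scalerA; congr (_ *: _); apply/rowP => i; rewrite !mxE tnth_torus_rot.
rewrite cosD sinD /Cexp/= expR0 !mul1r.
by apply/eqP; rewrite eq_complex/=; apply/andP; split; apply/eqP; ring.
Qed.

Lemma torus_point_periodic (t t' : n.-tuple angle) :
  (forall i, tnth t' i = tnth t i \/ tnth t' i = 2 * pi + tnth t i) ->
  torus_point t' = torus_point t.
Proof.
move=> h; apply/rowP => i; rewrite !mxE; have [->//|->] := h i.
by rewrite addrC mulr_natl cosD2pi sinD2pi.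
Qed.

End TorusFunctions.

(** * Bounds on compact polydiscs *)

Section CompactBound.
Context {R : realType}.

Lemma compact_closed_disc (r : R) : compact [set z : R[i] | normc z <= r].
Proof.
have csq : compact (`[- r, r]%classic `*` `[- r, r]%classic : set (R * R)).
  by apply: compact_setX; exact: segment_compact.
pose g (p : R * R) : R[i] := p.1 +i* p.2.
have cg : continuous g.
  move=> p; apply/(@cvgrPdist_lt _ R[i]) => e /gt0_cplx[-> e0].
  apply/(@nbhs_ballP R (R * R)%type); exists (complex.Re e / 2); first by rewrite /= divr_gt0.
  move=> q [/= h1 h2]; rewrite normc_lt_cplx; apply: (le_lt_trans (normc_le_ReIm _)).
  by move: h1 h2; rewrite /ball/=; lra.
have cK : compact (g @` (`[- r, r]%classic `*` `[- r, r]%classic)).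
  by apply: continuous_compact => //; exact: continuous_subspaceT.
apply: subclosed_compact cK _ => [z hz|z /= zr].
  rewrite /=; apply/ler_addgt0Pr => e e0.
  have [|w /= [wr]] := hz (ball z e%:C).
    by apply: nbhsx_ballx; rewrite ltcR.
  rewrite /ball/= normc_lt_cplx => zw.
  have -> : z = w + (z - w) by ring.
  by apply: normc_le2 => //; exact: ltW.
exists (complex.Re z, complex.Im z); last by case: z {zr}.
split; rewrite /= in_itv/=.
  by have := Re_norm_le z; rewrite ler_norml; lra.
by have := Im_norm_le z; rewrite ler_norml; lra.
Qed.

Lemma holomorphic_bounded n (f : 'rV[R[i]]_n -> R[i]) (r : R) :
  holomorphic f -> 0 <= r < 1 ->
  exists M : R, forall z : 'rV[R[i]]_n, (forall i, normc (z ord0 i) <= r) -> normc (f z) <= M.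
Proof.
move=> hf /andP[r0 r1].
pose A := [set v : 'rV[R[i]]_n | forall i, [set z : R[i] | normc z <= r] (v ord0 i)].
have cA : compact A.
  have := @rV_compact R[i] n (fun=> [set z : R[i] | normc z <= r]).
  by apply => i; exact: compact_closed_disc.
have A0 : A !=set0 by exists 0 => i; rewrite /= mxE normc0.
have nf (z : 'rV[R[i]]_n) : A z -> {for z, continuous (fun z => normc (f z))}.
  move=> Az; apply/(@cvgrPdist_le _ R^o _ (nbhs z) (nbhs_filter z)) => e e0.
  have Dz : polydisc R n z by move=> i; apply: le_lt_trans r1; exact: Az.
  have cz := differentiable_continuous (hf _ Dz).
  have [d d0 Hd] := continuous_epsilon cz e0.
  apply/nbhs_ballP; exists d%:C; first by rewrite /= ltcR.
  move=> w [_ zw]; apply: (@le_trans _ _ (normc (f w - f z))).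
    rewrite ler_norml; apply/andP; split; first by rewrite lerNl opprB le_normcB.
    by rewrite normc_distC le_normcB.
  by apply: Hd => i; rewrite normc_distC -normc_lt_cplx; exact: zw.
have cf : {within A, continuous (fun z => normc (f z))}.
  by apply: continuous_in_subspaceT => z; rewrite inE; exact: nf.
have [c _ hc] := compact_EVT_max A0 cA cf.
by exists (normc (f c)) => z hz; apply: hc; rewrite inE.
Qed.

End CompactBound.

(** * Means over the torus *)

Section TorusMeans.
Context {R : realType} {n : nat}.
Local Notation Cn := 'rV[R[i]]_n.
Local Notation angle := (measurableTypeR R).
Local Notation T := (n.-tuple angle).
Local Notation mu := (@torus_measure R n).

Lemma integral_uniform_seg_int (g : R -> R) :
  (forall y, {for y, continuous g}) -> (forall y, 0 <= g y) ->
  (\int[uniform_prob (@two_pi_gt0 R)]_y (g y)%:E =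
   ((2 * pi)^-1 * seg_int 0 (2 * pi) g)%:E)%E.
Proof.
move=> cg g0.
have mg : measurable_fun setT (g : angle -> R) by exact: continuous_measurable_fun.
rewrite integral_uniform; [|exact/measurable_EFinP|by move=> y; rewrite lee_fin].
rewrite subr0 EFinM; congr (_ * _)%E.
rewrite /seg_int /Rintegral fineK//.
apply: integrable_fin_num => //; apply: seg_integrable => y _; exact: cg.
Qed.

Definition tmean (H : T -> R) : R := \int[mu]_t H t.

(** Bounded functions have integrable products. *)
Definition tame (H : T -> R) :=
  measurable_fun setT H /\ exists M : R, forall t, `|H t| <= M.

Lemma tame_integrable H : tame H -> mu.-integrable setT (EFin \o H).
Proof.
move=> [mH [M hM]]; apply: measurable_bounded_integrable => //.
  by rewrite (le_lt_trans (probability_le1 _ _))// ltry.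
exists M; split; first exact: num_real.
by move=> x Mx t _; exact: le_trans (hM t) (ltW Mx).
Qed.

Lemma tmeanE H : tame H -> (\int[mu]_t (H t)%:E = (tmean H)%:E)%E.
Proof.
by move=> tH; rewrite /tmean /Rintegral fineK//; apply: integrable_fin_num => //; exact: tame_integrable.
Qed.

Lemma tame_cst (k : R) : tame (fun=> k).
Proof. by split; [exact: measurable_cst|exists `|k|]. Qed.

Lemma tameD H1 H2 : tame H1 -> tame H2 -> tame (fun t => H1 t + H2 t).
Proof.
move=> [m1 [M1 h1]] [m2 [M2 h2]]; split; first exact: measurable_funD.
by exists (M1 + M2) => t; rewrite (le_trans (ler_normD _ _))// lerD.
Qed.

Lemma tameM H1 H2 : tame H1 -> tame H2 -> tame (fun t => H1 t * H2 t).
Proof.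
move=> [m1 [M1 h1]] [m2 [M2 h2]]; split; first exact: measurable_funM.
by exists (M1 * M2) => t; rewrite normrM ler_pM.
Qed.

Lemma tmeanD H1 H2 : tame H1 -> tame H2 ->
  tmean (fun t => H1 t + H2 t) = tmean H1 + tmean H2.
Proof. by move=> t1 t2; rewrite /tmean RintegralD//; exact: tame_integrable. Qed.

Lemma tmeanZ (k : R) H : tame H -> tmean (fun t => k * H t) = k * tmean H.
Proof. by move=> tH; rewrite /tmean RintegralZl//; exact: tame_integrable. Qed.

Lemma tmean_cst (k : R) : tmean (fun=> k) = k.
Proof.
rewrite /tmean Rintegral_cst//.
by have /= -> := @probability_setT _ _ R mu; rewrite mulr1.
Qed.

Lemma tmean_le H1 H2 : tame H1 -> tame H2 -> (forall t, H1 t <= H2 t) ->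
  tmean H1 <= tmean H2.
Proof. by move=> t1 t2 h; apply: le_Rintegral => //; exact: tame_integrable. Qed.

(** The mean over the torus is the average of the means over the diagonal
    circles; adding a bound makes both functions nonnegative, as the exchange of
    integrals requires. *)
Lemma tmean_circles (H1 H2 : T -> R) : tame H1 -> tame H2 ->
  torus_periodic H1 -> torus_periodic H2 ->
  (forall t y, {for y, continuous (fun c : R => H1 (torus_rot c t))}) ->
  (forall t y, {for y, continuous (fun c : R => H2 (torus_rot c t))}) ->
  (forall t, seg_int 0 (2 * pi) (fun c => H1 (torus_rot c t)) =
             seg_int 0 (2 * pi) (fun c => H2 (torus_rot c t))) ->
  tmean H1 = tmean H2.
Proof.
move=> t1 t2 p1 p2 c1 c2 E.
have [M1 hM1] := t1.2; have [M2 hM2] := t2.2.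
pose M := Num.max M1 M2.
have avg H : tame H -> torus_periodic H ->
    (forall t y, {for y, continuous (fun c : R => H (torus_rot c t))}) ->
    (forall t, `|H t| <= M) ->
    ((tmean H + M)%:E = \int[mu]_t ((2 * pi)^-1 *
       (seg_int 0 (2 * pi) (fun c => H (torus_rot c t)) + M * (2 * pi)))%:E)%E.
  move=> tH pH cH hM.
  have tHM := tameD tH (tame_cst M).
  rewrite -{1}(tmean_cst M) -(tmeanD tH (tame_cst M)) -tmeanE//.
  rewrite torus_average//; last 3 first.
  - exact: tHM.1.
  - by move=> t; have := hM t; rewrite ler_norml; lra.
  - by move=> t t' tt'; rewrite (pH t t').
  apply: eq_integral => t _.
  have cHM : forall y, {for y, continuous (fun c : R => H (torus_rot c t) + M)}.
    by move=> y; apply: (@continuousD _ R^o R^o); [exact: cH|exact: cvg_cst].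
  rewrite (integral_uniform_seg_int cHM); last first.
    by move=> y; have := hM (torus_rot y t); rewrite ler_norml; lra.
  have p0 : 0 <= 2 * pi :> R by rewrite mulr_ge0// pi_ge0.
  rewrite seg_intD; [|by move=> y _; exact: cH|exact: seg_cont_cst].
  by rewrite seg_int_cst// subr0.
have hM1' t : `|H1 t| <= M by rewrite le_max hM1.
have hM2' t : `|H2 t| <= M by rewrite le_max hM2 orbT.
have := avg _ t1 p1 c1 hM1'; under eq_integral => t _ do rewrite E.
rewrite -(avg _ t2 p2 c2 hM2') => /(congr1 fine)/=; lra.
Qed.

Lemma tame_Re (f : Cn -> R[i]) (r : R) : holomorphic f -> 0 <= r < 1 ->
  tame (fun t => complex.Re (f (r%:C *: torus_point t))).
Proof.
move=> hf r01; split; first exact: measurable_Re_torus.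
have [M hM] := holomorphic_bounded hf r01; exists M => t.
apply: (le_trans (Re_norm_le _)); apply: hM => i.
have /andP[r0 _] := r01.
by rewrite !mxE normcM normc_real ger0_norm//= cos2Dsin2 sqrtr1 mulr1.
Qed.

Lemma tame_Im (f : Cn -> R[i]) (r : R) : holomorphic f -> 0 <= r < 1 ->
  tame (fun t => complex.Im (f (r%:C *: torus_point t))).
Proof.
move=> hf r01; split; first exact: measurable_Im_torus.
have [M hM] := holomorphic_bounded hf r01; exists M => t.
apply: (le_trans (Im_norm_le _)); apply: hM => i.
have /andP[r0 _] := r01.
by rewrite !mxE normcM normc_real ger0_norm//= cos2Dsin2 sqrtr1 mulr1.
Qed.

Lemma differentiable_slice (f : Cn -> R[i]) (t : T) u : holomorphic f ->
  normc u < 1 -> differentiable (fun u : R[i] => f (u *: torus_point t)) u.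
Proof.
move=> hf u1.
apply: (@differentiable_comp _ _ _ _ (fun u : R[i] => u *: torus_point t) f) => //.
by apply: hf => i; rewrite !mxE normcM /= cos2Dsin2 sqrtr1 mulr1.
Qed.

Lemma Cexp_ln (r y : R) : 0 < r -> Cexp (ln r +i* y) = r%:C * Cexp (0 +i* y).
Proof.
move=> r0; rewrite /Cexp/= lnK ?posrE// expR0 !mul1r.
by apply/eqP; rewrite eq_complex/=; apply/andP; split; apply/eqP; ring.
Qed.

(** On every slice [u |-> w (u t)] the circular means are the value at the
    centre. *)
Lemma tmean_value (w : Cn -> R[i]) (r : R) : holomorphic w -> 0 < r < 1 ->
  tmean (fun t => complex.Re (w (r%:C *: torus_point t))) = complex.Re (w 0).
Proof.
move=> hw r01; have /andP[r0 r1] := r01.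
have r01' : 0 <= r < 1 by rewrite ltW.
rewrite -[RHS]tmean_cst.
pose K t u := w (u *: torus_point t).
have rotE t c : complex.Re (w (r%:C *: torus_point (torus_rot c t))) =
    complex.Re (K t (Cexp (ln r +i* c))).
  by rewrite torus_point_rot /K Cexp_ln.
have dK t u : normc u < 1 -> differentiable (K t) u.
  by move=> u1; exact: differentiable_slice.
have lr : expR (ln r) < 1 by rewrite lnK ?posrE.
apply: tmean_circles.
- exact: tame_Re.
- exact: tame_cst.
- by move=> t t' tt'; rewrite (torus_point_periodic tt').
- by [].
- move=> t y; have -> : (fun c : R => complex.Re (w (r%:C *: torus_point (torus_rot c t)))) =
     (fun c => complex.Re (K t (Cexp (ln r +i* c)))) by apply/funext => c; rewrite rotE.
  apply: (closed_form_cont (@cdiff_closed_form _ (fun v => K t (Cexp v)) _ _ _)).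
  apply: differentiable_comp; first exact: differentiable_Cexp.
  by apply: dK; rewrite normc_Cexp.
- by move=> t y; exact: cvg_cst.
move=> t; under eq_fun do rewrite rotE.
have p0 : 0 <= 2 * pi :> R by rewrite mulr_ge0// pi_ge0.
rewrite seg_int_cst// subr0 [RHS]mulrC.
apply: (@circle_mean_puncture _ (K t) (w 0) 1) => //.
  by move=> u /andP[_ u1]; exact: dK.
move=> e e0.
have n0 : normc (0 : R[i]) < 1 by rewrite normc0.
have /cdiffP[D KD] := dK t 0 n0.
have [d d0 Hd] := KD 1 ltr01.
exists (Num.min d (e / (1 + normc D))).
  by rewrite lt_min d0 divr_gt0// ltr_pwDl// normc_ge0.
move=> u /andP[_]; rewrite lt_min => /andP[ud ue].
have := Hd u ud; rewrite add0r mul1r.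
have -> : K t 0 = w 0 by rewrite /K scale0r.
move=> h; have -> : K t u - w 0 = (K t u - w 0 - D * u) + D * u by ring.
apply: (le_trans (normc_le2 h (lexx _))); rewrite normcM.
move: ue; rewrite ltr_pdivlMr; last by rewrite ltr_pwDl// normc_ge0.
lra.
Qed.

Definition torus_pairing (f : Cn -> R[i]) (a b : R) (t : T) : R :=
  complex.Re (f (a%:C *: torus_point t) * (f (b%:C *: torus_point t))^*).

Lemma torus_pairingE f a b t : torus_pairing f a b t =
  complex.Re (f (a%:C *: torus_point t)) * complex.Re (f (b%:C *: torus_point t)) +
  complex.Im (f (a%:C *: torus_point t)) * complex.Im (f (b%:C *: torus_point t)).
Proof.
by rewrite /torus_pairing; case: (f _) (f _) => [x y] [z w] /=; ring.
Qed.

Lemma torus_pairing_diag f a t :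
  torus_pairing f a a t = normc (f (a%:C *: torus_point t)) ^+ 2.
Proof. by rewrite torus_pairingE normc_sqr !expr2. Qed.

Lemma tame_pairing f a b : holomorphic f -> 0 <= a < 1 -> 0 <= b < 1 ->
  tame (torus_pairing f a b).
Proof.
move=> hf a01 b01.
have -> : torus_pairing f a b = (fun t =>
    complex.Re (f (a%:C *: torus_point t)) * complex.Re (f (b%:C *: torus_point t)) +
    complex.Im (f (a%:C *: torus_point t)) * complex.Im (f (b%:C *: torus_point t))).
  by apply/funext => t; exact: torus_pairingE.
by apply: tameD; apply: tameM; first [exact: tame_Re|exact: tame_Im].
Qed.

(** For fixed [t], the function [u |-> f (u t) * (f ((a * b / u^* ) t))^*] is
    holomorphic in an annulus, and on the circle of radius [a] it is the
    pairing of the values of [f] at the radii [a] and [b].  Its circular means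
    do not depend on the radius, hence the pairing only depends on [a * b]. *)
Lemma tmean_pairing f a b c : holomorphic f -> 0 < a < 1 -> 0 < b < 1 ->
  0 < c -> a * b = c ^+ 2 ->
  tmean (torus_pairing f a b) = tmean (torus_pairing f c c).
Proof.
move=> hf.
wlog ab : a b / a <= b.
  move=> h a01 b01 c0 E; have [ab|/ltW ba] := leP a b; first exact: h.
  have := h b a ba b01 a01 c0; rewrite [b * a]mulrC => /(_ E) <-.
  congr tmean; apply/funext => t.
  by rewrite !torus_pairingE; ring.
move=> a01 b01 c0 E.
have /andP[a0 a1] := a01; have /andP[b0 b1] := b01.
have ac : a <= c.
  by rewrite -ler_sqr ?nnegrE ?(ltW a0) ?(ltW c0)// -E expr2 ler_pM2l.
have cb : c <= b.
  by rewrite -ler_sqr ?nnegrE ?(ltW b0) ?(ltW c0)// -E expr2 ler_pM2r.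
have c1 : c < 1 := le_lt_trans cb b1.
have [a01' b01' c01'] : [/\ 0 <= a < 1, 0 <= b < 1 & 0 <= c < 1].
  by rewrite !ltW// a1 b1 c1.
pose L := ln a + ln b.
have Lc : L = ln c + ln c by rewrite /L -!lnM ?posrE// E expr2.
pose G t w := f (Cexp w *: torus_point t) * (f (Cexp (L%:C - w^*) *: torus_point t))^*.
have dS t w : complex.Re w < 0 -> differentiable (fun w => f (Cexp w *: torus_point t)) w.
  move=> w0; apply: (@differentiable_comp _ _ _ _ (@Cexp R) (fun u : R[i] => f (u *: torus_point t))).
    exact: differentiable_Cexp.
  by apply: differentiable_slice => //; rewrite normc_Cexp -expR0 ltr_expR.
have dG t w : complex.Re w < 0 -> L - complex.Re w < 0 -> differentiable (G t) w.
  move=> w0 Lw; apply: differentiableM; first exact: dS.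
  apply: (@differentiable_reflection _ (fun w => f (Cexp w *: torus_point t))).
  by apply: dS; rewrite ReB; case: (w) Lw.
have la : ln a < 0 by rewrite ln_lt0.
have lb : ln b < 0 by rewrite ln_lt0.
have lc : ln c < 0 by rewrite ln_lt0// c0.
have GaE t y : torus_pairing f a b (torus_rot y t) = complex.Re (G t (ln a +i* y)).
  rewrite /torus_pairing 2!torus_point_rot -(Cexp_ln y a0) -(Cexp_ln y b0).
  have -> : ln b +i* y = L%:C - (ln a +i* y)^*.
    by apply/eqP; rewrite eq_complex /L/=; apply/andP; split; apply/eqP; ring.
  by [].
have GcE t y : torus_pairing f c c (torus_rot y t) = complex.Re (G t (ln c +i* y)).
  rewrite /torus_pairing torus_point_rot -(Cexp_ln y c0).
  have {2}-> : ln c +i* y = L%:C - (ln c +i* y)^*.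
    by apply/eqP; rewrite eq_complex Lc/=; apply/andP; split; apply/eqP; ring.
  by [].
have per d e : torus_periodic (torus_pairing f d e).
  by move=> t t' tt'; rewrite /torus_pairing (torus_point_periodic tt').
apply: tmean_circles.
- exact: tame_pairing.
- exact: tame_pairing.
- exact: per.
- exact: per.
- move=> t y; have -> : (fun d : R => torus_pairing f a b (torus_rot d t)) =
     (fun d => complex.Re (G t (ln a +i* d))) by apply/funext => d; rewrite GaE.
  by apply: (closed_form_cont (cdiff_closed_form _)); apply: dG; rewrite /L/=; lra.
- move=> t y; have -> : (fun d : R => torus_pairing f c c (torus_rot d t)) =
     (fun d => complex.Re (G t (ln c +i* d))) by apply/funext => d; rewrite GcE.
  by apply: (closed_form_cont (cdiff_closed_form _)); apply: dG; rewrite /= ?Lc; lra.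
move=> t; under eq_fun do rewrite GaE; under [in RHS]eq_fun do rewrite GcE.
apply: circle_mean_strip; first by rewrite ler_ln ?posrE.
  move=> w /andP[w1 w2]; apply: dG; rewrite ?Lc; last first.
    by have : L <= ln a + ln b by []; rewrite -Lc /L; lra.
  by lra.
move=> w; rewrite /G Cexp_2pi; congr (_ * (f (_ *: _))^*).
have -> : L%:C - (w + (0 +i* (2 * pi)))^* = L%:C - w^* + (0 +i* (2 * pi)).
  by case: w => x y; apply/eqP; rewrite eq_complex/=; apply/andP; split; apply/eqP; ring.
by rewrite Cexp_2pi.
Qed.

End TorusMeans.

(** * Hardy means and dilations *)

Section HardyMeans.
Context {R : realType} {n : nat}.
Local Notation Cn := 'rV[R[i]]_n.
Implicit Types (f g : Cn -> R[i]) (r s : R).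

(** The square of the [L2] norm over the torus of radius [r]. *)
Definition hmean f r : R := tmean (torus_pairing f r r).

Lemma hmeanE f r : holomorphic f -> 0 < r < 1 ->
  (\int[torus_measure n]_t (normc (f (r%:C *: torus_point t)) ^+ 2)%:E = (hmean f r)%:E)%E.
Proof.
move=> hf /andP[r0 r1]; rewrite /hmean -tmeanE; last by apply: tame_pairing; rewrite ?(ltW r0).
by apply: eq_integral => t _; rewrite torus_pairing_diag.
Qed.

Lemma hmean_ge0 f r : 0 <= hmean f r.
Proof. by apply: Rintegral_ge0 => t _; rewrite torus_pairing_diag sqr_ge0. Qed.

Lemma pairing_le f a b t :
  2 * torus_pairing f a b t <= torus_pairing f a a t + torus_pairing f b b t.
Proof.
rewrite !torus_pairingE; move: (complex.Re _) (complex.Im _) (complex.Re _) (complex.Im _).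
by move=> x y z w; have := sqr_ge0 (x - z); have := sqr_ge0 (y - w); lra.
Qed.

(** The means at [a] and [b] dominate the pairing of both radii, which only
    depends on their geometric mean [c]. *)
Lemma hmean_convex f a b c : holomorphic f -> 0 < a < 1 -> 0 < b < 1 -> 0 < c ->
  a * b = c ^+ 2 -> 2 * hmean f c <= hmean f a + hmean f b.
Proof.
move=> hf a01 b01 c0 E.
have [a01' b01'] : 0 <= a < 1 /\ 0 <= b < 1.
  by move: a01 b01 => /andP[? ->] /andP[? ->]; rewrite !ltW.
rewrite /hmean -(tmean_pairing hf a01 b01 c0 E) -tmeanZ; last exact: tame_pairing.
rewrite -tmeanD; [|exact: tame_pairing..].
apply: tmean_le; [|by apply: tameD; exact: tame_pairing|exact: pairing_le].
by apply: tameM; [exact: tame_cst|exact: tame_pairing].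
Qed.

(** The increments of a convex sequence increase, so after one strict increase
    it would grow linearly. *)
Lemma bounded_convex_seq (u : nat -> R) (S : R) :
  (forall k, 2 * u k.+1 <= u k + u k.+2) -> (forall k, u k <= S) ->
  u 1%N <= u 0%N.
Proof.
move=> conv hS; rewrite leNgt; apply/negP => lt.
have [d d0 d1] : exists2 d : R, 0 < d & d = u 1%N - u 0%N.
  by exists (u 1%N - u 0%N); rewrite ?subr_gt0.
have inc k : d <= u k.+1 - u k.
  by elim: k => [|k IH]; [rewrite d1 lexx|have := conv k; lra].
have lb k : u 0%N + k%:R * d <= u k.
  elim: k => [|k IH]; first by rewrite mul0r addr0.
  by have := inc k; rewrite -natr1 mulrDl mul1r; lra.
have [k kS] : exists k : nat, (S - u 0%N) / d < k%:R.
  by exists (Num.truncn ((S - u 0%N) / d)).+1; exact: truncnS_gt.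
have := hS k; have := lb k.
by move: kS; rewrite ltr_pdivrMr//; lra.
Qed.

(** The means are convex in [ln r] and bounded as [ln r] tends to [-oo]: look at
    the radii [s * q ^+ k] with [q = r / s]. *)
Lemma hmean_mono f (S : R) : holomorphic f ->
  (forall r, 0 < r < 1 -> hmean f r <= S) ->
  forall r s, 0 < r -> r <= s -> s < 1 -> hmean f r <= hmean f s.
Proof.
move=> hf hS r s r0 rs s1.
have s0 : 0 < s := lt_le_trans r0 rs.
pose q := r / s.
have q0 : 0 < q by rewrite divr_gt0.
have q1 : q <= 1 by rewrite ler_pdivrMr// mul1r.
have sq k : 0 < s * q ^+ k < 1.
  rewrite mulr_gt0 ?exprn_gt0//=; apply: le_lt_trans s1.
  by rewrite ler_piMr ?exprn_ile1// ltW.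
have := @bounded_convex_seq (fun k => hmean f (s * q ^+ k)) S.
have E : s * q = r by rewrite /q mulrC divfK ?gt_eqF.
rewrite expr0 expr1 mulr1 E; apply.
  move=> k; apply: hmean_convex (sq k) (sq k.+2) _ _ => //.
    by have /andP[] := sq k.+1.
  by rewrite !exprS; ring.
by move=> k; exact: hS (sq k).
Qed.

Lemma H2_hmean_bounded f : H2 R n f ->
  exists S : R, forall r, 0 < r < 1 -> hmean f r <= S.
Proof.
move=> [hf _]; rewrite /H2norm; set E := ereal_sup _ => fin.
have ub r : 0 < r < 1 -> ((hmean f r)%:E <= E)%E.
  move=> r01; apply: ereal_sup_ubound; exists r; first by rewrite /= in_itv.
  exact: hmeanE.
have h2 : 0 < (2^-1 : R) < 1 by apply/andP; split; lra.
case: E fin ub => [x| |] //= fin ub; first by exists x => r /ub; rewrite lee_fin.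
by have := ub _ h2.
Qed.

Lemma H2norm_lt f (K e : R) : holomorphic f -> 0 < e -> K < e ^+ 2 ->
  (forall r, 0 < r < 1 -> hmean f r <= K) -> (H2norm f < e%:E)%E.
Proof.
move=> hf e0 Ke hK; rewrite /H2norm; set E := ereal_sup _.
have EK : (E <= K%:E)%E.
  by apply: ge_ereal_sup => _ [r + <-]; rewrite /= in_itv/= => r01; rewrite hmeanE// lee_fin hK.
have h2 : 0 < (2^-1 : R) < 1 by apply/andP; split; lra.
have E0 : (0 <= E)%E.
  apply: (@le_trans _ _ (hmean f 2^-1)%:E); first by rewrite lee_fin hmean_ge0.
  apply: ereal_sup_ubound; exists 2^-1; first by rewrite /= in_itv.
  exact: hmeanE.
case: E EK E0 => [x| |] //; rewrite !lee_fin => xK x0 /=.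
rewrite lte_fin -[e]ger0_norm ?(ltW e0)// -sqrtr_sqr ltr_sqrt; first exact: le_lt_trans Ke.
by rewrite exprn_gt0.
Qed.

Definition dilate (rho : R) f : Cn -> R[i] := fun z => f (rho%:C *: z).

Lemma polydisc_dilate (rho : R) (z : Cn) : 0 <= rho <= 1 -> polydisc R n z ->
  polydisc R n (rho%:C *: z).
Proof.
move=> /andP[r0 r1] Dz i; rewrite mxE normcM normc_real ger0_norm//.
by apply: le_lt_trans (Dz i); rewrite ler_piMl// normc_ge0.
Qed.

Lemma holomorphic_dilate (rho : R) f : 0 <= rho <= 1 -> holomorphic f ->
  holomorphic (dilate rho f).
Proof.
move=> r01 hf z Dz.
apply: (@differentiable_comp _ _ _ _ (fun z : Cn => rho%:C *: z) f) => //.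
by apply: hf; exact: polydisc_dilate.
Qed.

Lemma holomorphicB f g : holomorphic f -> holomorphic g -> holomorphic (f - g)%R.
Proof. by move=> hf hg z Dz; apply: differentiableB; [exact: hf|exact: hg]. Qed.

(** The squared mean of [f - dilate (sigma ^+ 2) f] over the torus of radius [r] is
    [N r + N (sigma ^+ 2 * r) - 2 N (sigma * r)] for the means [N] of [f], and
    it increases with [r], so that only radii close to 1 matter. *)
Lemma dilate_approx f (e : R) : H2 R n f -> 0 < e ->
  exists2 rho : R, 0 < rho < 1 &
  forall r, 0 < r < 1 -> hmean (f - dilate rho f)%R r <= e.
Proof.
move=> Hf e0; have [hf _ _] := Hf; have [S0 hS0] := H2_hmean_bounded Hf.
pose A := [set hmean f r | r in [set r : R | 0 < r < 1]].
have h2 : 0 < (2^-1 : R) < 1 by apply/andP; split; lra.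
have sA : has_sup A.
  by split; [exists (hmean f 2^-1), 2^-1|exists S0 => _ [r r01 <-]; exact: hS0].
pose S := sup A.
have hS r : 0 < r < 1 -> hmean f r <= S.
  by move=> r01; apply: sup_upper_bound => //; exists r.
have [_ [r0 /andP[r00 r01] <-] Sr0] := sup_adherent e0 sA.
(* The square of [sg] is still at least [r0], a radius at which the mean is
   within [e] of the supremum. *)
pose sg := (1 + r0) / 2.
have [sg0 sg1] : 0 < sg /\ sg < 1 by rewrite /sg; split; lra.
have sgr : r0 <= sg * sg by have := sqr_ge0 (1 - r0); rewrite /sg; lra.
pose rho := sg ^+ 2.
have [rho0 rho1] : 0 < rho /\ rho < 1.
  by rewrite exprn_gt0// exprn_ilt1// ltW.
have rho01 : 0 <= rho <= 1 by rewrite !ltW.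
exists rho; first by rewrite rho0.
pose d := (f - dilate rho f)%R.
have hd : holomorphic d by apply: holomorphicB => //; exact: holomorphic_dilate.
have dE r : 0 < r < 1 -> hmean d r = hmean f r + hmean f (rho * r) - 2 * hmean f (sg * r).
  move=> /andP[r_0 r_1].
  have rr0 : 0 < rho * r by rewrite mulr_gt0.
  have rr1 : rho * r < 1 by rewrite mulr_ilt1// ltW.
  have E : r * (rho * r) = (sg * r) ^+ 2 by rewrite /rho; ring.
  have r_01 : 0 < r < 1 by rewrite r_0.
  have rr01 : 0 < rho * r < 1 by rewrite rr0.
  have r_01' : 0 <= r < 1 by rewrite ltW.
  have rr01' : 0 <= rho * r < 1 by rewrite ltW.
  have sr0 : 0 < sg * r by rewrite mulr_gt0.
  have t1 := tame_pairing hf r_01' r_01'.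
  have t2 := tame_pairing hf rr01' rr01'.
  have t3 := tameM (tame_cst (-2)) (tame_pairing hf r_01' rr01').
  have E2 : hmean f (sg * r) = tmean (torus_pairing f r (rho * r)).
    exact/esym/(tmean_pairing hf r_01 rr01 sr0 E).
  rewrite E2 /hmean.
  rewrite -mulNr -(tmeanZ _ (tame_pairing hf r_01' rr01')).
  rewrite -(tmeanD t1 t2) -(tmeanD (tameD t1 t2) t3).
  congr tmean; apply/funext => t; rewrite !torus_pairingE.
  have -> : d (r%:C *: torus_point t) =
      f (r%:C *: torus_point t) - f ((rho * r)%:C *: torus_point t).
    by rewrite /d /dilate !fctE scalerA -rmorphM.
  by case: (f _) (f _) => [x y] [z w] /=; ring.
have dle r : 0 < r < 1 -> hmean d r <= hmean f r - hmean f (sg * r).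
  move=> r01'; rewrite dE//; have /andP[r_0 r_1] := r01'.
  have : hmean f (rho * r) <= hmean f (sg * r).
    apply: (hmean_mono hf hS); first by rewrite mulr_gt0.
      rewrite /rho expr2 -mulrA; apply: ler_piMl; last exact: ltW.
      by apply: mulr_ge0; exact: ltW.
    by apply: le_lt_trans r_1; apply: ler_piMl; exact: ltW.
  by move: (hmean f _) (hmean f _) (hmean f _) => u v w; lra.
have dS r : 0 < r < 1 -> hmean d r <= S.
  move=> r01'; apply: (le_trans (dle _ r01')).
  by rewrite lerBlDr (le_trans (hS _ r01'))// lerDl hmean_ge0.
move=> r /andP[r_0 r_1].
pose r' := Num.max r sg.
have r'r : r <= r' by rewrite le_max lexx.
have r'sg : sg <= r' by rewrite le_max lexx orbT.
have r'1 : r' < 1 by rewrite gt_max r_1.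
have r'0 : 0 < r' := lt_le_trans r_0 r'r.
have r'01 : 0 < r' < 1 by rewrite r'0.
apply: (le_trans (hmean_mono hd dS r_0 r'r r'1)).
apply: (le_trans (dle _ r'01)).
have : hmean f r0 <= hmean f (sg * r').
  apply: (hmean_mono hf hS) => //; last by apply: le_lt_trans r'1; apply: ler_piMl; exact: ltW.
  by apply: (le_trans sgr); rewrite ler_pM2l.
have := hS _ r'01; move: Sr0; rewrite -/S.
by move: (hmean f _) (hmean f _) (hmean f _) => u v w; lra.
Qed.

Lemma hmean_le2 f g h (a b : R) r : holomorphic f -> holomorphic g ->
  holomorphic h -> 0 < r < 1 ->
  hmean (f - g)%R r <= a -> hmean (g - h)%R r <= b ->
  hmean (f - h)%R r <= 2 * a + 2 * b.
Proof.
move=> hf hg hh /andP[r0 r1] ha hb.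
have r01 : 0 <= r < 1 by rewrite ltW.
have tB (u v : Cn -> R[i]) : holomorphic u -> holomorphic v -> tame (torus_pairing (u - v)%R r r).
  by move=> hu hv; exact: (tame_pairing (holomorphicB hu hv) r01 r01).
have Z (u v : Cn -> R[i]) : holomorphic u -> holomorphic v -> tame (fun t => 2 * torus_pairing (u - v)%R r r t).
  by move=> hu hv; apply: tameM; [exact: tame_cst|exact: tB].
apply: (@le_trans _ _ (2 * hmean (f - g)%R r + 2 * hmean (g - h)%R r)); last by lra.
rewrite /hmean -(tmeanZ _ (tB _ _ hf hg)) -(tmeanZ _ (tB _ _ hg hh)).
rewrite -(tmeanD (Z _ _ hf hg) (Z _ _ hg hh)).
apply: (tmean_le (tB _ _ hf hh) (tameD (Z _ _ hf hg) (Z _ _ hg hh))).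
move=> t; rewrite !torus_pairingE.
rewrite -![(_ - _)%R (_ *: _)]/(_ (_ *: _) - _ (_ *: _)) !ReB.
have ImB (u v : R[i]) : complex.Im (u - v) = complex.Im u - complex.Im v.
  by case: u v => [? ?] [? ?].
rewrite !ImB; move: (f _) (g _) (h _) => [x1 y1] [x2 y2] [x3 y3] /=.
by have := sqr_ge0 (x1 - 2 * x2 + x3); have := sqr_ge0 (y1 - 2 * y2 + y3); lra.
Qed.

End HardyMeans.

(** * Density of M-ideals *)

Theorem theorem5p4 (R : realType) (n : nat) (n_ge1 : (1 <= n)%N)
    (J : set (Hinfty R n)) :
  is_M_ideal J -> J <> [set 0] ->
  H2closure (@Hinfty_fun R n @` J) = H2 R n.
Proof.
move=> [_ Jsub [P PL PJ]] Jn0.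
have [f0 [Jf0 f0n]] : exists f, J f /\ f <> 0.
  apply: contrapT => /forallNP H; apply: Jn0; apply/seteqP; split=> f /=.
    by move=> Jf; apply: contrapT => fn; apply: (H f).
  by move=> ->; case: Jsub.
apply/seteqP; split=> [f []//|f Hf]; split=> // e e0.
have [hf _ _] := Hf.
have [rho rho01 hrho] : exists2 rho : R, 0 < rho < 1 &
    forall r, 0 < r < 1 -> hmean (f - dilate rho f)%R r <= e ^+ 2 / 8.
  by apply: dilate_approx => //; rewrite divr_gt0// exprn_gt0.
have /andP[rho0 rho1] := rho01.
have hfr : holomorphic (dilate rho f).
  by apply: holomorphic_dilate => //; rewrite !ltW.
have [F FE] : exists F : Hinfty R n, forall z, polydisc R n z -> F z = dilate rho f z.
  apply: exists_Hinfty => //.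
  have [|M hM] := @holomorphic_bounded _ _ f rho hf; first by rewrite ltW.
  exists M => z Dz; apply: hM => i; rewrite mxE normcM normc_real gtr0_norm//.
  by rewrite ler_piMr// ltW//; exact: Dz.
have [M M0 FM] : exists2 M : R, 0 < M & rnorm F <= M.
  by exists (rnorm F + 1); [rewrite ltr_wpDl// rnorm_ge0|rewrite lerDl].
pose x := M^-1%:C *: F.
have x1 : rnorm x <= 1.
  rewrite rnormZ normc_real ger0_norm ?invr_ge0 ?(ltW M0)//.
  by rewrite ler_pdivrMl// mulr1.
have M2 : 0 < M ^+ 2 by rewrite exprn_gt0.
have e2 : 0 < e ^+ 2 by rewrite exprn_gt0.
(* The square mean of [M * (x - y)] will be at most [5 * eta * M ^+ 2], which is
   then at most [e ^+ 2 / 16]. *)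
have [eta eta0 [eta1 etae]] : exists2 eta : R, 0 < eta &
    eta <= 1 /\ eta <= e ^+ 2 / (80 * M ^+ 2).
  exists (Num.min 1 (e ^+ 2 / (80 * M ^+ 2))); last by rewrite !ge_min !lexx orbT.
  by rewrite lt_min ltr01 divr_gt0// mulr_gt0.
have [u [Ju u1 u0]] := near_one_at_zero Jsub PL PJ Jf0 f0n eta0.
have [y [Jy xyp xym]] := two_ball Jsub PL PJ x1 Ju u1 eta0.
pose g := M%:C *: y.
have Jg : J g by rewrite /g -[_ *: _]addr0; case: Jsub => J0; apply.
exists (Hinfty_fun g); first by exists g.
have hg : holomorphic g := Hinfty_holomorphic g.
have hF : holomorphic F := Hinfty_holomorphic F.
have hu : holomorphic u := Hinfty_holomorphic u.
apply: (@H2norm_lt _ _ _ (2 * (e ^+ 2 / 8) + 2 * (e ^+ 2 / 16)) e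
  (holomorphicB hf hg) e0); first by move: e2; clear; lra.
move=> r r01; have /andP[r_0 r_1] := r01.
have r01' : 0 <= r < 1 by rewrite ltW.
apply: (hmean_le2 hf hfr hg r01 (hrho _ r01)).
(* The parallelogram law bounds [|x - y| ^+ 2 + |u| ^+ 2] by [(1 + eta) ^+ 2],
   and [|u| ^+ 2 >= 2 Re u - 1]; what remains has a computable mean. *)
pose Q (t : n.-tuple (measurableTypeR R)) : R := M ^+ 2 *
  ((1 + eta) ^+ 2 + 1 + -2 * complex.Re (u (r%:C *: torus_point t))).
have tu := tame_Re hu r01'.
have tc := @tame_cst R n ((1 + eta) ^+ 2 + 1).
have tu2 := tameM (tame_cst (-2)) tu.
have tQ : tame Q by apply: tameM; [exact: tame_cst|exact: tameD].
apply: (@le_trans _ _ (tmean Q)).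
  apply: (tmean_le (tame_pairing (holomorphicB hfr hg) r01' r01') tQ) => t.
  rewrite torus_pairing_diag /Q.
  have Dt := polydisc_torus t r01'.
  move: Dt; set z := _ *: torus_point t => Dt.
  have -> : (dilate rho f - g)%R z = M%:C * (x z - y z).
    rewrite -[LHS]/(dilate rho f z - M%:C * y z) -FE//.
    have -> : x z = M^-1%:C * F z by [].
    by rewrite mulrBr mulrA -rmorphM mulfV ?gt_eqF// mul1r.
  rewrite normcM normc_real gtr0_norm// exprMn ler_pM2l ?exprn_gt0//.
  have hp := le_trans (le_rnorm (x - y + u) Dt) (ltW xyp).
  have hm := le_trans (le_rnorm (x - y - u) Dt) (ltW xym).
  have {}hp : normc (x z - y z + u z) <= 1 + eta := hp.
  have {}hm : normc (x z - y z - u z) <= 1 + eta := hm.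
  have sq v : normc v <= 1 + eta -> complex.Re v ^+ 2 + complex.Im v ^+ 2 <= (1 + eta) ^+ 2.
    by move=> h; rewrite -normc_sqr ler_sqr ?nnegrE ?normc_ge0//; lra.
  have := sq _ hp; have := sq _ hm; rewrite normc_sqr.
  move: (x z - y z) (u z) => [a b] [c d] /= h1 h2.
  by have := sqr_ge0 (c - 1); have := sqr_ge0 d; lra.
rewrite /Q (tmeanZ _ (tameD tc tu2)) (tmeanD tc tu2) tmean_cst (tmeanZ _ tu).
rewrite (tmean_value hu r01).
apply: (@le_trans _ _ (M ^+ 2 * (5 * eta))).
  rewrite ler_pM2l//; have : eta ^+ 2 <= eta by rewrite expr2 ler_piMr// ltW.
  by move: u0; clear; lra.
move: etae; rewrite ler_pdivlMr ?mulr_gt0//; clear; lra.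
Qed.
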